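(* Let $k$ and $c$ be two integers such that $k\ge 3$ and $1\le c\le k-1$. If $d=11$ or $d\ge 15$ ($d$ an integer), then there is no distance-regular graph $\Gamma$ with the quotient matrix $\boldsymbol{B}(k,d+1,c)$.
   Context: For an integer $t\ge 4$, $\boldsymbol{B}(k,t,c)$ is the $t\times t$ tridiagonal matrix with lower diagonal $(1,\ldots,1,c,k)$ (with $t-3$ ones), upper diagonal $(k,k-1,\ldots,k-1,k-c)$ (with $t-3$ entries $k-1$), and constant row sum $k$ (so the diagonal is zero). The quotient matrix of a distance-regular graph is taken with respect to the distance-partition from a vertex $x$: it is the matrix, with rows and columns indexed by $0,1,\ldots,d$ ($d$ the diameter), whose $(i,j)$ entry is the number of neighbours at distance $j$ from $x$ of any given vertex at distance $i$ from $x$. *)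

(* Defs.v *)
From mathcomp Require Import all_boot all_order all_algebra.

Set Implicit Arguments.
Unset Strict Implicit.
Unset Printing Implicit Defensive.

Import GRing.Theory.
Local Open Scope ring_scope.

Section Graphs.
Variable T : finType.
Implicit Types (e : rel T) (x y : T).

Definition simple_graph e := symmetric e /\ irreflexive e.

Definition connected_graph e := (0 < #|T|)%N /\ forall x y, connect e x y.

Definition has_walk e (n : nat) x y : bool :=
  [exists p : n.-tuple T, path e x p && (last x p == y)].

(* A shortest walk has length < #|T|; the value is #|T| when y is not
   reachable from x. *)
Definition gdist e x y : nat :=
  find (fun n => has_walk e n x y) (iota 0 #|T|).

Definition diameter e : nat := (\max_(x : T) \max_(y : T) gdist e x y)%N.

(* The number of neighbours of y at distance j from x. *)
Definition nbrs_at e x y (j : nat) : nat :=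
  #|[set z | e y z & gdist e x z == j]|.

(* With i the distance between x and y, nbrs_at e x y j is c_i, a_i, b_i for
   j = i-1, i, i+1, and 0 for any other j. *)
Definition distance_regular e :=
  [/\ simple_graph e, connected_graph e &
      forall x y x' y', gdist e x y = gdist e x' y' ->
        forall j, nbrs_at e x y j = nbrs_at e x' y' j].

Definition is_quotient_matrix e (d : nat) (M : 'M[int]_d.+1) :=
  diameter e = d /\
  forall x y (i j : 'I_d.+1), gdist e x y = i -> M i j = (nbrs_at e x y j)%:Z.

End Graphs.

Definition Bmx_lower (k : int) (t : nat) (c : int) : seq int :=
  nseq (t - 3) 1 ++ [:: c; k].

Definition Bmx_upper (k : int) (t : nat) (c : int) : seq int :=
  k :: nseq (t - 3) (k - 1) ++ [:: k - c].

(* Meaningful for t >= 4; every row then sums to k with a zero diagonal. *)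
Definition Bmx (k : int) (t : nat) (c : int) : 'M[int]_t :=
  \matrix_(i < t, j < t)
    if i == j.+1 :> nat then (Bmx_lower k t c)`_j
    else if j == i.+1 :> nat then (Bmx_upper k t c)`_i
    else 0.

(* Main.v *)
Require Import Defs.
From mathcomp Require Import all_boot all_order all_algebra all_field.
From mathcomp Require Import ring lra zify.

Set Implicit Arguments.
Unset Strict Implicit.
Unset Printing Implicit Defensive.

Import Order.TTheory GRing.Theory Num.Theory.
Local Open Scope ring_scope.

(** If the graph exists, the eigenspace of its adjacency matrix for an eigenvalue
    theta has dimension |V| / S, where S = sum_i v_i w_i for the left and right
    eigenvectors v, w of the quotient matrix; so S is rational. Write q = k - 1,
    (k - 1 : c - 1) = (w : u) in lowest terms, and x = theta^2 / q - 2. The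
    eigenvalues other than k and -k come from the roots x of an integer polynomial
    f, a combination of Chebyshev polynomials with coefficients w and u, and
    evaluating S shows that every root x satisfies
    S' (2 - x)(w^2 + u^2 + w u x)
      = (q^2 + 1 - q x)(d w^2 + (d - 2) u^2 + (d - 1) w u x)
    with S' rational. Hence f is a product of integer polynomials of degree at
    most 2, and each quadratic factor lies in this pencil.

    Modulo 2, f is a shifted Chebyshev polynomial V_L, up to a factor x, or a
    separable polynomial V_{h+1} + V_h. Over the field with two elements there are
    too few polynomials of degree at most 2 for the latter to have degree larger
    than 2, and as V_{2n+1} = (V_{n+1} + V_n)^2 and V_{2n} = x V_n^2, the index L is
    2^b, 3 * 2^b or 5 * 2^b. For large b, high divisibility of f modulo 2 by a power
    of x forces f(0), f(-2) or f'(-2) to be divisible by 2^(2^(b-1)), which is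
    false; L = 12, 10, 20 are excluded similarly at x + 1 and at x^2 + x - 1.

    Only d = 11 with u, w odd remains. There some quadratic factor of f changes
    sign between 3/5 and 2, and its two roots contradict the monotonicity of the
    pencil on the interval containing all the roots of f. *)

(** * Rationality of the norms of the eigenvectors *)

Section Distance.
Variables (T : finType) (e : rel T).

Lemma gdistxx x : gdist e x x = 0%N.
Proof.
have /prednK cT : (0 < #|T|)%N by apply/card_gt0P; exists x.
rewrite /gdist -cT /= ifT //.
by apply/existsP; exists [tuple] => /=.
Qed.

Lemma gdist_eq0 x y : gdist e x y = 0%N -> x = y.
Proof.
have /prednK cT : (0 < #|T|)%N by apply/card_gt0P; exists x.
rewrite /gdist -cT /=; case: ifP => // /existsP[p /andP[_ /eqP <-]] _.
by rewrite tuple0.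
Qed.

Lemma gdist_diameter x y : (gdist e x y <= diameter e)%N.
Proof.
by apply: leq_trans (leq_bigmax x); apply: (leq_bigmax (F := gdist e x)).
Qed.

End Distance.

(** Column [j] of the equation determines the entry [j.+1] of [v] from the earlier ones, since [M]
    has nonzero subdiagonal entries and zeros below them. *)
Lemma left_eigenvector_eq0 (F : fieldType) (n : nat) (M : 'M[F]_n.+1) (z : F)
    (v : 'rV_n.+1) :
    (forall i j : 'I_n.+1, (j.+1 < i)%N -> M i j = 0) ->
    (forall i j : 'I_n.+1, i = j.+1 :> nat -> M i j != 0) ->
  v *m M = z *: v -> v 0 0 = 0 -> v = 0.
Proof.
move=> M0 Mn0 vM v0; apply/rowP=> i; rewrite mxE.
have [m] := ubnP (nat_of_ord i); elim: m i => // m IHm [[|i] ltin] /=.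
  by move=> _; rewrite -[RHS]v0; congr (v _ _); apply: val_inj.
rewrite ltnS => ltim.
have/(congr1 (fun u : 'rV_n.+1 => u 0 (Ordinal (ltnW ltin)))) := vM.
rewrite [RHS]mxE IHm // mulr0 mxE (bigD1 (Ordinal ltin)) //= big1 ?addr0.
  by move/eqP; rewrite mulf_eq0 (negPf (Mn0 _ _ _)) // orbF => /eqP.
move=> j; rewrite -val_eqE /= neq_ltn => /orP[ltji|ltij].
  by rewrite IHm ?mul0r //; apply: leq_trans ltji _.
by rewrite M0 ?mulr0.
Qed.

Section Spheres.
Variables (T : finType) (e : rel T) (d : nat) (A : 'M[int]_d.+1).
Variables (F : fieldType) (z : F).
Hypotheses (e_sym : symmetric e) (eA : is_quotient_matrix e A).
Let M : 'M[F]_d.+1 := map_mx intr A.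

Let dist x y : 'I_d.+1 := inord (gdist e x y).

Let distE x y : dist x y = gdist e x y :> nat.
Proof. by rewrite inordK // ltnS -(proj1 eA) gdist_diameter. Qed.

Let card_nbrs x y j :
  M (dist x y) j = \sum_(t | e y t && (dist x t == j)) 1.
Proof.
rewrite mxE (proj2 eA x y) // /nbrs_at sumr_const -pmulrn; congr (_ *+ _).
by apply: eq_card => t; rewrite !inE -distE.
Qed.

(** Neighbours of [y] are grouped by distance from [x]; the group sizes form a row of the quotient
    matrix. *)
Lemma radial_eigenfunction (w : 'cV[F]_d.+1) x y : M *m w = z *: w ->
  \sum_(t | e y t) w (dist x t) 0 = z * w (dist x y) 0.
Proof.
move/colP/(_ (dist x y)); rewrite !mxE => <-.
rewrite (partition_big (dist x) xpredT) //=; apply: eq_bigr => j _.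
rewrite card_nbrs mulr_suml; apply: eq_bigr => t /andP[_ /eqP->].
by rewrite mul1r.
Qed.

(** Double counting of the edges between spheres around [x]; [e_sym] allows counting them from
    either end. *)
Lemma sphere_sum_eigen (g : T -> F) x :
    (forall y, \sum_(t | e y t) g t = z * g y) ->
  let v := \row_i \sum_(y | dist x y == i) g y in v *m M = z *: v.
Proof.
move=> gz v; apply/rowP=> i; rewrite !mxE mulr_sumr.
under [RHS]eq_bigr => y _ do rewrite -gz.
rewrite (exchange_big_dep xpredT) //= (partition_big (dist x) xpredT) //=.
apply: eq_bigr => j _; rewrite mxE mulr_suml; apply: eq_bigr => y /eqP<-.
rewrite card_nbrs mulr_sumr; apply: eq_big => [t|t _]; last by rewrite mulr1.
by rewrite e_sym andbC.
Qed.

Hypotheses (M0 : forall i j : 'I_d.+1, (j.+1 < i)%N -> M i j = 0).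
Hypotheses (Mn0 : forall i j : 'I_d.+1, i = j.+1 :> nat -> M i j != 0).

(* The matrix [w (dist x y)] is [v *m w] times a projection; its trace is the
   number of vertices. *)
Lemma eigenvector_norm (v : 'rV[F]_d.+1) (w : 'cV[F]_d.+1) :
    v *m M = z *: v -> M *m w = z *: w -> v 0 0 = 1 -> w 0 0 = 1 ->
  let S := (v *m w) 0 0 in S = 0 \/ exists r : nat, S * r%:R = #|T|%:R.
Proof.
move=> vM Mw v0 w0 S.
pose W : 'M[F]_#|T| :=
  \matrix_(i, j) w (dist (enum_val i) (enum_val j)) 0.
(* The sphere sums of [g] form a left eigenvector with entry [g x] at 0, so by uniqueness they equal
   [g x *: v]. *)
have sumg g x : (forall y, \sum_(t | e y t) g t = z * g y) ->
    \sum_y w (dist x y) 0 * g y = S * g x.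
  move=> gz; have := sphere_sum_eigen x gz => /=.
  set v' := \row_i _ => v'M.
  have v'v : v' = g x *: v.
    apply/eqP; rewrite -subr_eq0; apply/eqP.
    apply: (left_eigenvector_eq0 (z := z) M0 Mn0).
      by rewrite mulmxBl v'M -scalemxAl vM scalerBr !scalerA mulrC.
    rewrite !mxE v0 mulr1 (big_pred1 x) ?subrr // => y /=.
    rewrite -val_eqE /= distE; apply/eqP/eqP => [/gdist_eq0->//|->].
    by rewrite gdistxx.
  rewrite (partition_big (dist x) xpredT) //= mulrC -[_ * S]/(g x * S).
  rewrite /S mxE mulr_sumr; apply: eq_bigr => i _.
  move/rowP/(_ i): v'v; rewrite !mxE => vi; rewrite mulrA -vi mulr_suml.
  by apply: eq_bigr => y /eqP->; rewrite mulrC.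
have WW : W *m W^T = S *: W^T.
  apply/matrixP=> i j; rewrite !mxE.
  rewrite -(sumg (fun y => w (dist (enum_val j) y) 0) (enum_val i)); last first.
    by move=> y; apply: radial_eigenfunction.
  rewrite [RHS](reindex (@enum_val T predT)); last first.
    exact: onW_bij (@enum_val_bij T).
  by apply: eq_bigr => l _; rewrite !mxE.
have [->|nzS] := eqVneq S 0; [by left | right; exists (\rank W)].
(* [W *m W^T] is symmetric, hence so is [S *: W^T], and [S] can be cancelled. *)
have WT : W^T = W.
  have /(congr1 trmx) := WW; rewrite trmx_mul trmxK WW linearZ /= trmxK.
  by move/(congr1 ( *:%R S^-1)); rewrite !scalerA mulVf // !scale1r.
(* In a rank factorization [W = C *m R], cancelling the outer factors of [W *m W = S *: W] leaves
   [R *m C = S%:M], whose trace is [S] times the rank. *)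
have := row_base_free W; have := col_base_full W.
move: (mulmx_base W) WW; rewrite WT.
move: (col_base W) (row_base W) => C R CRW; rewrite -{1 2 3}CRW => WW /row_fullP[C' CC'].
case/row_freeP=> R' RR'.
have RC : R *m C = S%:M.
  transitivity (C' *m ((C *m R) *m (C *m R)) *m R').
    by rewrite !mulmxA CC' mul1mx -!mulmxA RR' mulmx1.
  by rewrite WW -scalemxAr -scalemxAl mulmxA CC' mul1mx RR' scalemx1.
have : \tr W = S * (\rank W)%:R.
  by rewrite -{1}CRW mxtrace_mulC RC mxtrace_scalar mulr_natr.
move<-; rewrite /mxtrace (eq_bigr (fun=> 1)) ?sumr_const ?card_ord //.
by move=> i _; rewrite mxE (_ : dist _ _ = 0) ?w0 //; apply: ord_inj;
   rewrite distE gdistxx.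
Qed.

End Spheres.

(* The Chebyshev polynomials of the second kind, with the index shifted by one
   and the variable halved: [cheb (z + z^-1) n = (z^n - z^-n) / (z - z^-1)]. *)
Fixpoint cheb (R : pzRingType) (x : R) (n : nat) : R :=
  if n is m.+1 then if m is l.+1 then x * cheb x m - cheb x l else 1 else 0.

Lemma chebSS (R : pzRingType) (x : R) n :
  cheb x n.+2 = x * cheb x n.+1 - cheb x n.
Proof. by []. Qed.

Lemma rmorph_cheb (R S : pzRingType) (f : {rmorphism R -> S}) x n :
  f (cheb x n) = cheb (f x) n.
Proof.
suff [] : f (cheb x n) = cheb (f x) n /\ f (cheb x n.+1) = cheb (f x) n.+1 by [].
elim: n => [|n [IH0 IH1]]; first by rewrite /= rmorph0 rmorph1.
by split=> //; rewrite !chebSS rmorphB rmorphM IH0 IH1.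
Qed.

(** The recurrence step from [(a, b)] to [(x * a - b, a)] preserves the form
    [a ^+ 2 + b ^+ 2 - x * a * b]. *)
Lemma cheb_conserved (R : comPzRingType) (x : R) n :
  cheb x n.+1 ^+ 2 + cheb x n ^+ 2 - x * cheb x n.+1 * cheb x n = 1.
Proof. by elim: n => [|n <-]; rewrite ?chebSS /=; ring. Qed.

(** * Explicit eigenvectors of the tridiagonal quotient matrix *)

Section TridiagonalSums.
Variables (R : pzRingType) (k c : int) (n : nat).
Let B := Bmx k n.+4 c.
Let lower i : R := ((Bmx_lower k n.+4 c)`_i)%:~R.
Let upper i : R := ((Bmx_upper k n.+4 c)`_i)%:~R.

Let Bmx_entry (i j : 'I_n.+4) : (B i j)%:~R =
  (if i == j.+1 :> nat then lower j else 0) +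
  (if j == i.+1 :> nat then upper i else 0).
Proof.
rewrite mxE; case: eqP => [->|_].
  by rewrite ifF ?addr0 //; apply/eqP; lia.
by rewrite add0r; case: ifP.
Qed.

Lemma Bmx_mulmx_row (v : nat -> R) (i : 'I_n.+4) :
  ((\row_(j < n.+4) v j) *m map_mx intr B) 0 i =
  (if (i < n.+3)%N then v i.+1 * lower i else 0) +
  (if (0 < i)%N then v i.-1 * upper i.-1 else 0).
Proof.
have if0 b (x y : R) : x * (if b then y else 0) = if b then x * y else 0.
  by case: b; rewrite ?mulr0.
rewrite mxE; under eq_bigr => j _ do
  rewrite mxE [X in _ * X]mxE Bmx_entry mulrDr !if0.
rewrite big_split /= -!big_mkcond /= (big_ord1_eq _ (fun j => v j * lower i)).
congr (_ + _); case: i => [[|i] lti] /=; first by rewrite big_pred0.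
under eq_bigl => j do rewrite eqSS eq_sym.
by rewrite (big_ord1_eq _ (fun j => v j * upper j)) (ltnW lti).
Qed.

Lemma Bmx_mulmx_col (v : nat -> R) (i : 'I_n.+4) :
  (map_mx intr B *m (\col_(j < n.+4) v j)) i 0 =
  (if (i < n.+3)%N then upper i * v i.+1 else 0) +
  (if (0 < i)%N then lower i.-1 * v i.-1 else 0).
Proof.
have if0 b (x y : R) : (if b then y else 0) * x = if b then y * x else 0.
  by case: b; rewrite ?mul0r.
rewrite mxE; under eq_bigr => j _ do
  rewrite mxE [X in _ * X]mxE Bmx_entry mulrDl !if0.
rewrite big_split /= -!big_mkcond /= addrC.
rewrite (big_ord1_eq _ (fun j => upper i * v j)).
congr (_ + _); case: i => [[|i] lti] /=; first by rewrite big_pred0.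
under eq_bigl => j do rewrite eqSS eq_sym.
by rewrite (big_ord1_eq _ (fun j => lower j * v j)) (ltnW lti).
Qed.
End TridiagonalSums.

Section Eigenvectors.
Variables (F : fieldType) (k c : int) (n : nat) (q s r X : F).
Let B := Bmx k n.+4 c.
Let y := cheb X.
Hypotheses (qE : q = (k - 1)%:~R) (sE : s = (c - 1)%:~R).
Hypotheses (r2 : r ^+ 2 = q) (q0 : q != 0) (k0 : q + 1 != 0) (qs0 : q - s != 0).
Hypothesis yd : q * y n.+3 + s * y n.+1 = 0.
(** The eigenvalue equation [yd] makes the last three values [y n.+1], [y n.+2], [y n.+3] explicit
    multiples of [nu]. *)
Let nu := y n.+2 / (q - s).

(* [cheb_shift i] is [y i.+1 - y i.-1 / q], which also makes sense at
   [i = 0]. *)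
Let cheb_shift i := (1 + q^-1) * y i.+1 - q^-1 * X * y i.
Let a := cheb_shift.

Let aSS i : a i.+2 = X * a i.+1 - a i.
Proof. by rewrite /a /cheb_shift /y !chebSS; ring. Qed.

Let a0 : a 0 = 1 + q^-1. Proof. by rewrite /a /cheb_shift /y /=; ring. Qed.
Let a1 : a 1 = X. Proof. by rewrite /a /cheb_shift /y /=; ring. Qed.

Let norm := (1 + q^-1) ^+ 2 - q^-1 * X ^+ 2.

Let a_conserved i : a i.+1 ^+ 2 + a i ^+ 2 - X * a i.+1 * a i = norm.
Proof.
elim: i => [|i <-]; first by rewrite a0 a1 /norm; ring.
by rewrite aSS; ring.
Qed.

(** By [a_conserved], [(4 - X ^+ 2) * a i.+1 ^+ 2] is [2 * norm] minus a second difference of the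
    squares of [a], so the sum telescopes. *)
Let a_sqr_sum m : (4 - X ^+ 2) * \sum_(i < m) a i.+1 ^+ 2 =
  2 * m%:R * norm - (a m.+1 ^+ 2 - a m ^+ 2) + (a 1 ^+ 2 - a 0 ^+ 2).
Proof.
elim: m => [|m IHm]; first by rewrite big_ord0; ring.
rewrite big_ord_recr /= mulrDr IHm -(a_conserved m) aSS -natr1; ring.
Qed.

Let y_d1 : y n.+2 = (q - s) * nu.
Proof. by rewrite /nu mulrC divfK. Qed.

Let y_d2 : y n.+1 = q * X * nu.
Proof.
apply: (mulfI qs0); have := chebSS X n.+1; rewrite -/y y_d1 => yS.
have -> : y n.+1 = X * ((q - s) * nu) - y n.+3 by rewrite yS; ring.
have qy : q * y n.+3 = - (s * y n.+1).
  by apply/eqP; rewrite -subr_eq0 opprK yd.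
have -> : (q - s) * (X * ((q - s) * nu) - y n.+3) =
   (q - s) * (X * ((q - s) * nu)) + s * y n.+3 - q * y n.+3 by ring.
rewrite qy yS; ring.
Qed.

Let y_d : y n.+3 = - (s * X * nu).
Proof. by have := chebSS X n.+1; rewrite -/y y_d1 y_d2 => ->; ring. Qed.

Let a_d1 : a n.+2 = - ((s + 1) * X * nu).
Proof. by rewrite /a /cheb_shift y_d y_d1; field. Qed.

Let a_d2 : a n.+1 = ((q - s) * (1 + q^-1) - X ^+ 2) * nu.
Proof. by rewrite /a /cheb_shift y_d1 y_d2; field. Qed.

Let nu_norm : nu ^+ 2 * ((q - s) ^+ 2 + q * s * X ^+ 2) = 1.
Proof.
by have := cheb_conserved X n.+1; rewrite -/y y_d1 y_d2 => <-; ring.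
Qed.

(** Both eigenvectors are [a] rescaled by powers of [r], with entry 0 equal to 1. The exceptions at
    the ends come from the irregular entries of the matrix; there [nu] avoids a division by
    [s + 1]. *)
Let vl (i : nat) : F := if i == 0%N then 1 else if (i <= n.+1)%N then r ^+ i * a i else
  if i == n.+2 then - (r ^+ n.+2 * X * nu) else - (r ^+ n.+1 * (q - s) * nu).

Let wr i : F := if (i <= n.+2)%N then q / (q + 1) * r ^- i * a i else
  - ((s + 1) * nu * r ^- n.+1).

Let lower i : F := ((Bmx_lower k n.+4 c)`_i)%:~R.
Let upper i : F := ((Bmx_upper k n.+4 c)`_i)%:~R.

Let lower_small i : (i <= n)%N -> lower i = 1.
Proof.
move=> lein; rewrite /lower /Bmx_lower nth_cat size_nseq.
have -> : (n.+4 - 3 = n.+1)%N by lia.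
by rewrite ltnS lein nth_nseq ltnS lein.
Qed.
Let lower_d1 : lower n.+1 = s + 1.
Proof.
rewrite /lower /Bmx_lower nth_cat size_nseq.
have -> : (n.+4 - 3 = n.+1)%N by lia.
by rewrite ltnn subnn /= sE -[1 in RHS]/(1%:~R) -intrD subrK.
Qed.
Let lower_d : lower n.+2 = q + 1.
Proof.
rewrite /lower /Bmx_lower nth_cat size_nseq.
have -> : (n.+4 - 3 = n.+1)%N by lia.
rewrite ltnNge ltnW //=.
by rewrite subSnn /= qE -[1 in RHS]/(1%:~R) -intrD subrK.
Qed.
Let upper_0 : upper 0 = q + 1.
Proof. by rewrite /upper /= qE -[1 in RHS]/(1%:~R) -intrD subrK. Qed.
Let upper_small i : (i <= n)%N -> upper i.+1 = q.
Proof.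
move=> lein; rewrite /upper -[_`_i.+1]/((nseq (n.+4 - 3) (k - 1) ++ [:: k - c])`_i).
rewrite nth_cat size_nseq; have -> : (n.+4 - 3 = n.+1)%N by lia.
by rewrite ltnS lein nth_nseq ltnS lein.
Qed.
Let upper_d1 : upper n.+2 = q - s.
Proof.
rewrite /upper -[_`_n.+2]/((nseq (n.+4 - 3) (k - 1) ++ [:: k - c])`_n.+1).
rewrite nth_cat size_nseq; have -> : (n.+4 - 3 = n.+1)%N by lia.
by rewrite ltnn subnn /= qE sE -intrB; congr _%:~R; ring.
Qed.

Let r0 : r != 0.
Proof. by apply: contraNneq q0 => r0; rewrite -r2 r0 expr0n. Qed.

Let vl_d1 : vl n.+2 = - (r ^+ n.+2 * X * nu).
Proof. by rewrite /vl /= ltnn eqxx. Qed.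
Let vl_d : vl n.+3 = - (r ^+ n.+1 * (q - s) * nu).
Proof. by rewrite /vl /= gtn_eqF // ifF //; lia. Qed.

Let vl_lower i : (i <= n.+1)%N -> vl i.+1 * lower i = r ^+ i.+1 * a i.+1.
Proof.
rewrite leq_eqVlt => /orP[/eqP->|lein].
  by rewrite /vl /= eqxx ltnn lower_d1 a_d1; ring.
by rewrite lower_small // mulr1 /vl /= lein.
Qed.

Let vl_upper i : (i <= n.+1)%N -> vl i * upper i = q * r ^+ i * a i.
Proof.
case: i => [_|i lein]; first by rewrite /vl /= upper_0 a0; field.
by rewrite /vl /= lein upper_small // mulrC mulrA.
Qed.

Lemma left_eigenvector :
  let v := \row_(j < n.+4) vl j in v *m map_mx intr B = (r * X) *: v.
Proof.
apply/rowP=> i; rewrite Bmx_mulmx_row -/(lower _) -/(upper _) !mxE.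
case: i => [[|i] /= lti]; first by rewrite addr0 vl_lower // a1 /vl /=; ring.
have [ltin | ltni | ->] := ltngtP i n.+1; first 1 last.
- have -> : i = n.+2 by apply/eqP; rewrite eqn_leq ltni andbT.
  by rewrite ltnn upper_d1 vl_d1 vl_d [r ^+ n.+2]exprS; ring.
- rewrite ltnSn vl_upper // lower_d vl_d1 vl_d a_d2 !exprS.
  by field: r2.
rewrite ltnS ltnW // vl_lower // vl_upper 1?ltnW // aSS /vl /= ltin.
by rewrite !exprS -r2; ring.
Qed.

Let wr_small i : (i <= n.+2)%N -> wr i = q / (q + 1) * r ^- i * a i.
Proof. by rewrite /wr => ->. Qed.
Let wr_d : wr n.+3 = - ((s + 1) * nu * r ^- n.+1).
Proof. by rewrite /wr ltnn. Qed.

Lemma right_eigenvector :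
  let w := \col_(j < n.+4) wr j in map_mx intr B *m w = (r * X) *: w.
Proof.
apply/colP=> i; rewrite Bmx_mulmx_col -/(lower _) -/(upper _) !mxE.
case: i => [[|i] /= lti].
  rewrite addr0 upper_0 !wr_small // a0 a1 expr0 expr1.
  by field: r2; rewrite q0 oner_eq0 k0 r0.
have [ltin | ltni | ->] := ltngtP i n.+1; first 1 last.
- have -> : i = n.+2 by apply/eqP; rewrite eqn_leq ltni andbT.
  rewrite ltnn lower_d wr_d wr_small // a_d1 [r ^+ n.+2]exprS.
  by field: r2; rewrite ?q0 ?k0 ?r0 ?expf_neq0.
- rewrite ltnSn lower_d1 upper_d1 wr_d !wr_small // a_d1 a_d2 [r ^+ n.+2]exprS.
  by field: r2; rewrite ?q0 ?k0 ?r0 ?expf_neq0.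
rewrite ltnS ltnW // lower_small // upper_small // !wr_small //; try lia.
rewrite aSS !exprS; by field: r2; rewrite ?q0 ?k0 ?r0 ?expf_neq0.
Qed.

Let wr0 : wr 0 = 1.
Proof. by rewrite wr_small // a0 expr0; field; rewrite q0 oner_eq0 k0. Qed.

(** The powers of [r] cancel in [vl i * wr i], so [S] is a telescoping sum of squares plus boundary
    terms, and only [q], [s] and [x] survive. *)
Lemma eigenvector_inner :
  let S := ((\row_(j < n.+4) vl j) *m (\col_(j < n.+4) wr j)) 0 0 in
  let x := X ^+ 2 - 2 in
  S * (q * (q + 1) * (2 - x) * (q ^+ 2 + s ^+ 2 + q * s * x)) =
  2 * (q ^+ 2 + 1 - q * x) *
    (n.+3%:R * q ^+ 2 + n.+1%:R * s ^+ 2 + n.+2%:R * (q * s * x)).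
Proof.
move=> S x.
have SE : S = 1 + q / (q + 1) * \sum_(i < n.+1) a i.+1 ^+ 2 +
    q / (q + 1) * (s + 1) * X ^+ 2 * nu ^+ 2 + (q - s) * (s + 1) * nu ^+ 2.
  rewrite /S mxE (eq_bigr (fun j : 'I_n.+4 => vl j * wr j)); last first.
    by move=> j _; rewrite !mxE.
  rewrite big_ord_recl 2!big_ord_recr /= /bump /= !add1n wr0 vl_d vl_d1 wr_d.
  rewrite [wr n.+2]wr_small // a_d1 {1}/vl /= mulr1 -!addrA; congr (_ + _).
  rewrite mulr_sumr; congr (_ + (_ + _)).
  - apply: eq_bigr => -[i ltin] _ /=.
    rewrite add1n wr_small ?(leq_trans ltin) // /vl /= ltin.
    by field; rewrite k0 expf_neq0.
  - by field; rewrite k0 expf_neq0.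
  by field; rewrite expf_neq0.
have sumE := a_sqr_sum n.+1.
have E1 := nu_norm.
have -> : S * (q * (q + 1) * (2 - x) * (q ^+ 2 + s ^+ 2 + q * s * x)) =
  (S * (q + 1) * (4 - X ^+ 2)) * (q * (q ^+ 2 + s ^+ 2 + q * s * x)).
  by rewrite /x; ring.
have -> : S * (q + 1) * (4 - X ^+ 2) =
  q * ((4 - X ^+ 2) * \sum_(i < n.+1) a i.+1 ^+ 2) + (4 - X ^+ 2) * ((q + 1) +
     q * (s + 1) * X ^+ 2 * nu ^+ 2 + (q - s) * (s + 1) * (q + 1) * nu ^+ 2).
  by rewrite SE; field.
rewrite sumE a_d1 a_d2 a0 a1 /norm.
have EE : q ^+ 2 + s ^+ 2 + q * s * x = (q - s) ^+ 2 + q * s * X ^+ 2.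
  by rewrite /x; ring.
rewrite EE /x; set E := _ + q * s * X ^+ 2 in E1 *.
(* [S * (q + 1) * (4 - X ^+ 2)] is [T0 + T1 * nu ^+ 2]; multiplying by [E] eliminates [nu], because
   [nu ^+ 2 * E = 1]. *)
pose T0 := q * (2 * n.+1%:R * ((1 + q^-1) ^+ 2 - q^-1 * X ^+ 2) + X ^+ 2 -
  (1 + q^-1) ^+ 2) + (4 - X ^+ 2) * (q + 1).
pose T1 := q * (((q - s) * (1 + q^-1) - X ^+ 2) ^+ 2 - (s + 1) ^+ 2 * X ^+ 2)
  + (4 - X ^+ 2) * (q * (s + 1) * X ^+ 2 + (q - s) * (s + 1) * (q + 1)).
transitivity (q * (T0 * E + T1 * (nu ^+ 2 * E))).
  by rewrite /T0 /T1; ring.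
by rewrite E1 /T0 /T1 /E -!natr1; field.
Qed.

Lemma eigenvector_norm_eq (T : finType) (e : rel T) :
    symmetric e -> is_quotient_matrix e B -> s + 1 != 0 ->
  let x := X ^+ 2 - 2 in
  exists S : F, (S = 0 \/ exists m : nat, S * m%:R = #|T|%:R) /\
    S * (q * (q + 1) * (2 - x) * (q ^+ 2 + s ^+ 2 + q * s * x)) =
    2 * (q ^+ 2 + 1 - q * x) *
    (n.+3%:R * q ^+ 2 + n.+1%:R * s ^+ 2 + n.+2%:R * (q * s * x)).
Proof.
move=> e_sym eB c0 x; eexists; split; last exact: eigenvector_inner.
apply: (eigenvector_norm e_sym eB _ _ left_eigenvector right_eigenvector).
- move=> i j ltji; rewrite !mxE !ifF //; apply/eqP => eij.
    by rewrite eij ltnNge leqW in ltji.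
  by rewrite eij ltnn in ltji.
- move=> i j eij; rewrite !mxE eij eqxx -/(lower j).
  have [ltjn | ltnj | ->] := ltngtP j n.+1; first 1 last.
  + have -> : j = n.+2 :> nat; last by rewrite lower_d.
    by apply/eqP; rewrite eqn_leq ltnj andbT -2!ltnS -eij ltn_ord.
  + by rewrite lower_d1.
  by rewrite lower_small ?oner_eq0.
- by rewrite mxE.
by rewrite mxE wr0.
Qed.

End Eigenvectors.

(** * Factors of the characteristic polynomial *)

Section SmallFactors.
Local Notation pZtoQ := (map_poly (intr : int -> rat)).
Local Notation pZtoC := (map_poly (intr : int -> algC)).
Local Notation pQtoC := (map_poly (ratr : rat -> algC)).

(** The gcd of [f] with the [p] attached to one of its roots has degree 1 or 2 and is integral up to
    scaling, by the Gauss lemma; induction handles the cofactor. A gcd of degree 2 is associate to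
    [p]. The final constant is kept as a factor. *)
Lemma prod_small_factors (f : {poly int}) (A : {poly rat} -> Prop) :
    f != 0 ->
    (forall x, root (pZtoC f) x ->
       exists p, [/\ A p, p != 0, (size p <= 3)%N & root (pQtoC p) x]) ->
  exists fs : seq {poly int}, f = \prod_(g <- fs) g /\
    forall g, g \in fs ->
      (size g <= 3)%N /\ (size g = 3%N -> exists2 p, A p & p %= pZtoQ g).
Proof.
have mapC (g : {poly int}) : pZtoC g = pQtoC (pZtoQ g).
  by rewrite -map_poly_comp; apply: eq_map_poly => i /=; rewrite ratr_int.
have sizeQ (g : {poly int}) : size (pZtoQ g) = size g.
  by rewrite size_map_inj_poly //; apply: intr_inj.
have [m] := ubnP (size f); elim: m f => // m IHm f ltfm f0 fA.
have [lef1|gtf1] := leqP (size f) 1.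
  exists [:: f]; rewrite big_seq1; split=> // g; rewrite inE => /eqP->.
  by split=> [|f3]; [apply: leq_trans lef1 _ | rewrite f3 in lef1].
have /closed_rootP[x fx] : size (pZtoC f) != 1.
  by rewrite mapC size_map_poly sizeQ neq_ltn gtf1 orbT.
have [p [Ap p0 lep3 px]] := fA x fx.
pose h := gcdp (pZtoQ f) p.
have hx : root (pQtoC h) x by rewrite gcdp_map root_gcd -mapC fx px.
have h0 : h != 0 by rewrite gcdp_eq0 (negPf p0) andbF.
have h_gt1 : (1 < size h)%N.
  by rewrite -(size_map_poly (ratr : {rmorphism rat -> algC})) (root_size_gt1 _ hx)
    ?map_poly_eq0.
have [g [a a0 hg] [r fE]] := dvdpP_rat_int (dvdp_gcdl (pZtoQ f) p).
have gh : size g = size h by rewrite /h hg size_scale // sizeQ.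
have r0 : r != 0 by apply: contraNneq f0 => r0; rewrite fE r0 mulr0.
have g0 : g != 0 by apply: contraNneq f0 => g0; rewrite fE g0 mul0r.
have [||rs [rE rsP]] := IHm r _ r0.
- rewrite fE size_mul // in ltfm; move: ltfm h_gt1; rewrite -gh.
  case: (size g) => [|[|l]] //=; rewrite addSn /= => lt _.
  by apply: leq_ltn_trans (leq_addl l _) _; rewrite -ltnS.
- by move=> z rz; apply: fA; rewrite fE rmorphM rootM rz orbT.
exists (g :: rs); rewrite big_cons -rE; split=> // g'; rewrite inE.
case/orP=> [/eqP->|/rsP//]; rewrite gh; split.
  by apply: leq_trans lep3; rewrite dvdp_leq // dvdp_gcdr.
move=> h3; exists p => //; rewrite eqp_sym.
have : pZtoQ g %= h by rewrite /h hg eqp_sym eqp_scale.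
move=> /eqp_trans; apply; rewrite -dvdp_size_eqp ?dvdp_gcdr // -/h h3.
by rewrite eqn_leq lep3 andbT -h3 dvdp_leq ?dvdp_gcdr.
Qed.

End SmallFactors.

(** Up to a factor [X] for even [m], [cheb X m] is a polynomial in [X ^+ 2 - 2]; this is that
    polynomial. *)
Definition half_cheb (R : pzRingType) (x : R) (m : nat) : R :=
  if odd m then cheb x m./2.+1 + cheb x m./2 else cheb x m./2.

Lemma rmorph_half_cheb (R S : pzRingType) (f : {rmorphism R -> S}) x m :
  f (half_cheb x m) = half_cheb (f x) m.
Proof. by rewrite /half_cheb; case: odd; rewrite ?rmorphD !rmorph_cheb. Qed.

Lemma cheb_half (R : comPzRingType) (X : R) m :
  cheb X m = (if odd m then 1 else X) * half_cheb (X ^+ 2 - 2) m.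
Proof.
have H l : cheb X l.*2 = X * cheb (X ^+ 2 - 2) l /\
   cheb X l.*2.+1 = cheb (X ^+ 2 - 2) l.+1 + cheb (X ^+ 2 - 2) l.
  elim: l => [|l [IH0 IH1]]; first by rewrite /=; split; ring.
  have E : cheb X l.+1.*2 = X * cheb (X ^+ 2 - 2) l.+1.
    by rewrite doubleS chebSS IH1 IH0; ring.
  by split=> //; rewrite doubleS chebSS -doubleS E IH1 chebSS; ring.
rewrite /half_cheb -{1}[m]odd_double_half; case: odd.
  by rewrite mul1r; case: (H m./2).
by case: (H m./2).
Qed.

(* For [k - 1 : c - 1 = w : u], the roots of [char_factor w u n] are the values
   of [theta ^+ 2 / (k - 1) - 2] at the eigenvalues [theta] of
   [Bmx k n.+4 c]. *)
Definition char_factor (w u : int) (n : nat) : {poly int} :=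
  w%:P * half_cheb 'X n.+3 + u%:P * half_cheb 'X n.+1.

(** [pencil_den] and [pencil_num] come from the two sides of [eigenvector_inner], with [q : s]
    reduced to [w : u]; the factor [q * (q + 1) / 2] goes into the multiplier [S]. *)
Definition pencil_den (R : nzRingType) (w u : R) : {poly R} :=
  (2%:P - 'X) * ((w ^+ 2 + u ^+ 2)%:P + (w * u)%:P * 'X).

Definition pencil_num (R : nzRingType) (q w u : R) (n : nat) : {poly R} :=
  ((q ^+ 2 + 1)%:P - q%:P * 'X) *
  ((n.+3%:R * w ^+ 2 + n.+1%:R * u ^+ 2)%:P + (n.+2%:R * w * u)%:P * 'X).

Definition in_pencil (R : nzRingType) (q w u : R) n (p : {poly R}) :=
  exists S, p = S%:P * pencil_den w u - pencil_num q w u n.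

Lemma size_pencil (R : nzRingType) (q w u : R) n p :
  in_pencil q w u n p -> (size p <= 3)%N.
Proof.
have size_lin (a b : R) : (size (a%:P + b%:P * 'X)%R <= 2)%N.
  rewrite (leq_trans (size_polyD _ _)) // geq_max.
  rewrite (leq_trans (size_polyC_leq1 _)) //=.
  by rewrite (leq_trans (size_polyMleq _ _)) // size_polyX addn2 ltnS size_polyC_leq1.
have size_quad (a b a' b' : R) :
    (size ((a%:P + b%:P * 'X) * (a'%:P + b'%:P * 'X))%R <= 3)%N.
  rewrite (leq_trans (size_polyMleq _ _)) //.
  by rewrite -subn1 leq_subLR (leq_add (size_lin _ _) (size_lin _ _)).
case=> S ->; rewrite (leq_trans (size_polyD _ _)) // geq_max size_polyN.
rewrite /pencil_den /pencil_num.
have -> : 2%:P - 'X = 2%:P + (-1)%:P * 'X :> {poly R}.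
  by rewrite polyCN polyC1 mulN1r.
rewrite -[- (q%:P * 'X)]mulNr -polyCN !size_quad andbT.
rewrite (leq_trans (size_polyMleq _ _)) //.
rewrite -subn1 leq_subLR (leq_add (size_polyC_leq1 _)) //.
Qed.

Lemma horner_pencil_den (R : comNzRingType) (w u x : R) :
  (pencil_den w u).[x] = (2 - x) * (w ^+ 2 + u ^+ 2 + w * u * x).
Proof. by rewrite /pencil_den !hornerE. Qed.

Lemma horner_pencil_num (R : comNzRingType) (q w u x : R) n :
  (pencil_num q w u n).[x] = (q ^+ 2 + 1 - q * x) *
    (n.+3%:R * w ^+ 2 + n.+1%:R * u ^+ 2 + n.+2%:R * w * u * x).
Proof. by rewrite /pencil_num !hornerE. Qed.

Lemma map_pencil_den (R S : nzRingType) (f : {rmorphism R -> S}) w u :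
  map_poly f (pencil_den w u) = pencil_den (f w) (f u).
Proof.
rewrite /pencil_den rmorphM rmorphB /= [map_poly f (_ + _)]rmorphD.
rewrite /= [map_poly f (_ * 'X)]rmorphM /= map_polyX !map_polyC /=.
by rewrite rmorph_nat [f (_ + _)]rmorphD !rmorphXn rmorphM.
Qed.

Lemma map_pencil_num (R S : nzRingType) (f : {rmorphism R -> S}) q w u n :
  map_poly f (pencil_num q w u n) = pencil_num (f q) (f w) (f u) n.
Proof.
rewrite /pencil_num rmorphM rmorphB /= [map_poly f (_ + _ * 'X)]rmorphD.
rewrite /= ![map_poly f (_ * 'X)]rmorphM /= map_polyX !map_polyC /=.
by rewrite !(rmorph_nat f, rmorphD f, rmorphM f, rmorphXn f, rmorph1 f).
Qed.

Lemma horner_char_factor (R : comNzRingType) (w u : int) n (x : R) :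
  (map_poly intr (char_factor w u n)).[x] =
  w%:~R * half_cheb x n.+3 + u%:~R * half_cheb x n.+1.
Proof.
have hx m : (map_poly intr (half_cheb 'X m)).[x] = half_cheb x m.
  rewrite rmorph_half_cheb /= map_polyX -[LHS]/(horner_eval x _).
  by rewrite rmorph_half_cheb /= /horner_eval hornerX.
rewrite /char_factor rmorphD !rmorphM /= !map_polyC /=.
by rewrite hornerD !hornerM !hornerC !hx.
Qed.

Section GraphPencil.
Variables (T : finType) (e : rel T) (k c g w u : int) (n : nat).
Hypotheses (k3 : 3 <= k) (c_bounds : 1 <= c <= k - 1).
Hypotheses (e_sym : symmetric e) (eB : is_quotient_matrix e (Bmx k n.+4 c)).
Hypothesis T_gt0 : (0 < #|T|)%N.
Hypotheses (g_gt0 : 0 < g) (kE : k - 1 = g * w) (cE : c - 1 = g * u).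

(** A root [x] yields the eigenvalue [sqrtC q * X] with [X = sqrtC (x + 2)]. As [S] is rational, the
    norm identity is a rational quadratic relation for [x]. *)
Lemma char_factor_pencil (x : algC) :
    root (map_poly intr (char_factor w u n)) x ->
  exists p : {poly rat}, [/\ in_pencil (k - 1)%:~R w%:~R u%:~R n p, p != 0,
    (size p <= 3)%N & root (map_poly ratr p) x].
Proof.
move/rootP=> fx; pose X := sqrtC (x + 2).
have xE : x = X ^+ 2 - 2 by rewrite sqrtCK addrK.
pose q : algC := (k - 1)%:~R; pose s : algC := (c - 1)%:~R.
have intr_gt0 (z : int) : 0 < z -> z%:~R != 0 :> algC.
  by move=> z_gt0; rewrite intr_eq0 gt_eqF.
have yd : q * cheb X n.+3 + s * cheb X n.+1 = 0.
  rewrite horner_char_factor in fx.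
  rewrite !cheb_half -xE !oddS negbK /q /s kE cE !intrM.
  rewrite -[RHS](mulr0 (g%:~R * (if odd n then X else 1))) -fx.
  by case: odd => /=; ring.
have rE : sqrtC q ^+ 2 = q by rewrite sqrtCK.
have w_gt0 : 0 < w by rewrite -(pmulr_rgt0 _ g_gt0) -kE; lia.
have u_ge0 : 0 <= u by rewrite -(pmulr_rge0 _ g_gt0) -cE; lia.
have [||||S [Srat]] := eigenvector_norm_eq erefl erefl rE _ _ _ yd e_sym eB.
- by apply: intr_gt0; lia.
- by rewrite /q -[1]/(1%:~R) -intrD; apply: intr_gt0; lia.
- by rewrite -intrB; apply: intr_gt0; lia.
- by rewrite -[1]/(1%:~R) -intrD; apply: intr_gt0; lia.
rewrite /= -xE => SE.
have [S' S'E] : exists S' : rat, ratr S' = S.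
  case: Srat => [->|[m Sm]]; first by exists 0; rewrite rmorph0.
  have m0 : m%:R != 0 :> algC.
    apply: contraTneq T_gt0 => m0.
    by rewrite lt0n -(pnatr_eq0 algC) -Sm m0 mulr0 eqxx.
  exists (#|T|%:R / m%:R).
  by rewrite rmorphM fmorphV !rmorph_nat -Sm mulfK.
pose p : {poly rat} := (S' * (k - 1)%:~R * ((k - 1)%:~R + 1) / 2)%:P *
  pencil_den w%:~R u%:~R - pencil_num (k - 1)%:~R w%:~R u%:~R n.
have pP : in_pencil (k - 1)%:~R w%:~R u%:~R n p by eexists; reflexivity.
exists p; split=> //; last 2 first.
- exact: size_pencil pP.
- apply/rootP; rewrite /p rmorphB rmorphM /= map_polyC map_pencil_den.
  rewrite map_pencil_num hornerD hornerN hornerCM horner_pencil_den horner_pencil_num /=.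
  have -> : ratr (S' * (k - 1)%:~R * ((k - 1)%:~R + 1) / 2) =
      S * q * (q + 1) / 2 :> algC.
    by rewrite fmorph_div /= rmorph_nat rmorphM rmorphM /= S'E
      [ratr (_ + 1)]rmorphD /= ratr_int rmorph1.
  have g0 : g%:~R != 0 :> algC by apply: intr_gt0.
  rewrite !ratr_int -/q; apply: (mulfI g0); apply: (mulfI g0); rewrite !mulr0.
  have two0 : 2 != 0 :> algC by rewrite pnatr_eq0.
  apply: (mulfI two0); rewrite mulr0.
  have qE : q = g%:~R * w%:~R by rewrite /q kE intrM.
  have sE : s = g%:~R * u%:~R by rewrite /s cE intrM.
  have E1 : q ^+ 2 + s ^+ 2 + q * s * x = g%:~R ^+ 2 *
      (w%:~R ^+ 2 + u%:~R ^+ 2 + w%:~R * u%:~R * x) by rewrite qE sE; ring.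
  have E2 : n.+3%:R * q ^+ 2 + n.+1%:R * s ^+ 2 + n.+2%:R * (q * s * x) =
      g%:~R ^+ 2 * (n.+3%:R * w%:~R ^+ 2 + n.+1%:R * u%:~R ^+ 2 +
        n.+2%:R * w%:~R * u%:~R * x) by rewrite qE sE; ring.
  move/eqP: SE; rewrite -/q -/s E1 E2 -subr_eq0 => /eqP <-.
  by field.
(* At 2 the denominator vanishes, while the numerator is positive because [q ^+ 2 + 1 - 2 * q] is a
   nonzero square. *)
apply/eqP => p0; have : p.[2] = 0 by rewrite p0 horner0.
rewrite /p hornerD hornerN hornerCM horner_pencil_den horner_pencil_num subrr.
rewrite mul0r mulr0 sub0r => /eqP; rewrite oppr_eq0 => /eqP num0.
have q2 : 2 <= (k - 1)%:~R :> rat by rewrite -[2]/(2%:~R) ler_int; lia.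
have w0 : 0 < w%:~R :> rat by rewrite ltr0z.
have u0 : 0 <= u%:~R :> rat by rewrite ler0z.
move/eqP: num0; rewrite gt_eqF // mulr_gt0 //; first by nra.
rewrite ltr_wpDr ?mulr_ge0 ?ler0n // 1?ltW // ltr_wpDr ?mulr_ge0 ?ler0n ?sqr_ge0 //.
by rewrite mulr_gt0 ?ltr0n ?exprn_gt0.
Qed.

End GraphPencil.

(** * Reduction modulo 2 *)

Section ChebIdentities.
Variables (R : comNzRingType) (x : R).

Lemma cheb_doubleS n :
  cheb x n.*2.+1 = cheb x n.+1 ^+ 2 - cheb x n ^+ 2 /\
  cheb x n.*2.+2 = x * cheb x n.+1 ^+ 2 - 2 * cheb x n.+1 * cheb x n.
Proof.
elim: n => [|n [IH1 IH2]]; first by rewrite /=; split; ring.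
have E1 : cheb x n.+1.*2.+1 = cheb x n.+2 ^+ 2 - cheb x n.+1 ^+ 2.
  by rewrite doubleS chebSS IH2 IH1 (chebSS x n); ring.
split=> //; rewrite chebSS E1 doubleS IH2 (chebSS x n); ring.
Qed.

End ChebIdentities.

Lemma size_cheb (R : nzRingType) n :
  (size (cheb 'X n : {poly R}) <= n)%N /\ (cheb 'X n.+1 : {poly R})`_n = 1.
Proof.
suff : [/\ (size (cheb 'X n : {poly R}) <= n)%N,
  (size (cheb 'X n.+1 : {poly R}) <= n.+1)%N & (cheb 'X n.+1 : {poly R})`_n = 1].
  by case.
elim: n => [|n [IH0 IH1 IHc]].
  by rewrite /= size_poly0 size_poly1 coefC.
split=> //; first rewrite chebSS (leq_trans (size_polyD _ _)) // geq_max.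
  rewrite size_polyN (leq_trans IH0) ?andbT //; last by do 2!apply: leqW.
  by rewrite (leq_trans (size_polyMleq _ _)) // size_polyX.
rewrite chebSS coefB coefXM /= IHc [X in _ - X]nth_default ?subr0 //.
exact: leq_trans IH0 _.
Qed.

(** The factor ['X ^+ 2 - 4] clears denominators. The identity serves for separability modulo 2 and
    for a derivative at -1. *)
Lemma deriv_cheb (R : comNzRingType) n :
  let V := @cheb {poly R} 'X in
  ('X ^+ 2 - 4) * (V n)^`() = n%:R * (2 * V n.+1 - 'X * V n) - 'X * V n.
Proof.
move=> V; suff [] :
  ('X ^+ 2 - 4) * (V n)^`() = n%:R * (2 * V n.+1 - 'X * V n) - 'X * V n /\
  ('X ^+ 2 - 4) * (V n.+1)^`() =
     n.+1%:R * (2 * V n.+2 - 'X * V n.+1) - 'X * V n.+1 by [].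
elim: n => [|n [IH0 IH1]].
  by rewrite /V /= deriv0 -polyC1 derivC; split; ring.
split=> //; rewrite {1}/V chebSS -/V derivB derivM derivX.
transitivity (('X ^+ 2 - 4) * V n.+1 + 'X * (('X ^+ 2 - 4) * (V n.+1)^`()) -
   ('X ^+ 2 - 4) * (V n)^`()); first by ring.
rewrite IH0 IH1 /V (chebSS 'X n.+1) (chebSS 'X n) -!natr1; ring.
Qed.

Lemma poly_size3E (R : nzSemiRingType) (p : {poly R}) : (size p <= 3)%N ->
  p = (p`_0)%:P + (p`_1)%:P * 'X + (p`_2)%:P * 'X ^+ 2.
Proof.
move=> p3; rewrite -{1}(take_poly_id p3) /take_poly poly_def.
by rewrite !big_ord_recr big_ord0 /= add0r expr0 expr1 -!mul_polyC mulr1.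
Qed.

(** Separability makes [p %/ g] coprime to [g], hence to [q]; as it divides [q ^+ n], it is a
    unit. *)
Lemma separable_dvdp_exp (F : fieldType) (p q : {poly F}) n :
  separable_poly p -> p %| q ^+ n -> p %| q.
Proof.
move=> sep_p pqn; set g := gcdp p q.
have pE : p = (p %/ g) * g by rewrite divpK ?dvdp_gcdl.
have co_g : coprimep (p %/ g) g.
  by apply: separable_coprime sep_p _; rewrite -pE.
have co_q : coprimep (p %/ g) q.
  apply/coprimepP => r rp rq; apply: (coprimepP _ _ co_g) => //.
  by rewrite dvdp_gcd rq andbT {1}pE (dvdp_trans rp) ?dvdp_mulIl.
have : p %/ g %| q ^+ n by apply: dvdp_trans pqn; rewrite {2}pE dvdp_mulIl.
rewrite -[q ^+ n]mulr1 Gauss_dvdpr ?coprimep_expr // => d1.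
by rewrite pE -[q]mul1r dvdp_mul ?dvdp_gcdr.
Qed.

Section ModTwo.
Local Notation F2 := 'F_2.
Local Notation V := (@cheb {poly F2} 'X).
Local Notation mod2 := (map_poly (intr : int -> F2)).

Let two0 : 2 = 0 :> {poly F2}.
Proof. by rewrite -[2]/(2%:R) -polyC_natr; congr _%:P; apply: val_inj. Qed.

Let oppF (p : {poly F2}) : - p = p.
Proof. by apply/eqP; rewrite eq_sym -addr_eq0 -mulr2n -mulr_natl two0 mul0r. Qed.

Let F2P (z : F2) : z = 0 \/ z = 1.
Proof. by case: z => [[|[|//]] ?]; [left|right]; apply: val_inj. Qed.

Lemma mod2_cheb n : mod2 (cheb 'X n) = V n.
Proof. by rewrite rmorph_cheb /= map_polyX. Qed.

(** Its roots in an algebraic closure are the [z + z^-1] with [z ^+ n.*2.+1 = 1] and [z != 1]. *)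
Definition cheb_pair n : {poly F2} := V n.+1 + V n.

Lemma cheb_mod2_odd n : V n.*2.+1 = cheb_pair n ^+ 2.
Proof.
rewrite (cheb_doubleS _ n).1 /cheb_pair.
by rewrite -[- (_ ^+ 2)]oppF opprK; ring: two0.
Qed.

Lemma cheb_mod2_even n : V n.*2 = 'X * V n ^+ 2.
Proof.
case: n => [|n]; first by rewrite /=; ring.
by rewrite doubleS (cheb_doubleS _ n).2 two0 !mul0r subr0.
Qed.

Lemma cheb_mod2_pow2 b m : V (2 ^ b * m) = 'X ^+ (2 ^ b).-1 * V m ^+ (2 ^ b).
Proof.
elim: b => [|b IHb]; first by rewrite mul1n mul1r expr1.
rewrite expnS -mulnA mul2n cheb_mod2_even IHb exprMn -!exprM mulrA -exprS.
rewrite [(2 ^ b * 2)%N]mulnC; congr ('X ^+ _ * _).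
by have := expn_gt0 2 b; case: (2 ^ b)%N => // l _; rewrite mulnC !mul2n.
Qed.

Lemma horner0_cheb_pair n : (cheb_pair n).[0] = 1.
Proof.
elim: n => [|n IHn]; first by rewrite /cheb_pair /= !hornerE.
rewrite -IHn /cheb_pair chebSS !hornerE.
by have /(congr1 (fun p => p.[0])) := oppF (V n); rewrite hornerN addrC => ->.
Qed.

Lemma size_cheb_pair n : size (cheb_pair n) = n.+1.
Proof.
have [sn cn] := size_cheb F2 n; have [sn1 _] := size_cheb F2 n.+1.
rewrite /cheb_pair size_polyDl.
  apply/eqP; rewrite eqn_leq sn1 ltnNge; apply: contraTN isT => le.
  by have := cn; rewrite nth_default // => /eqP; rewrite eq_sym oner_eq0.
rewrite ltnNge; apply: contraTN isT => le.
by have := cn; rewrite nth_default // (leq_trans le).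
Qed.

(** Modulo 2, ['X] times the derivative is [V n.+1] or [V n], according to the parity of [n]. A
    common divisor with [cheb_pair n] thus divides both, and these are coprime by
    [cheb_conserved]. *)
Lemma separable_cheb_pair n : separable_poly (cheb_pair n).
Proof.
rewrite unlock; apply/coprimepP => p pA pA'.
have Xd : 'X ^+ 2 * (cheb_pair n)^`() = 'X * (n%:R * V n.+1 + n.+1%:R * V n).
  have dV m : ('X ^+ 2 - 4) * (V m)^`() =
    m%:R * (2 * V m.+1 - 'X * V m) - 'X * V m := deriv_cheb F2 m.
  have four0 : 4 = 0 :> {poly F2} by rewrite (natrM _ 2 2) two0 mul0r.
  have {}dV m : 'X ^+ 2 * (V m)^`() = m%:R * ('X * V m) + 'X * V m.
    by have := dV m; rewrite two0 four0 mul0r subr0 sub0r mulrN !oppF.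
  rewrite /cheb_pair derivD mulrDr !dV -!natr1.
  by rewrite -[RHS]addr0 -(mul0r ('X * V n.+1)) -two0; ring.
have Xn0 : 'X != 0 :> {poly F2} by rewrite polyX_eq0.
have XA' : 'X * (cheb_pair n)^`() = n%:R * V n.+1 + n.+1%:R * V n.
  by apply: (mulfI Xn0); rewrite -Xd expr2 mulrA.
have [pV1 pV] : p %| V n.+1 /\ p %| V n.
  have pX : p %| n%:R * V n.+1 + n.+1%:R * V n by rewrite -XA' dvdp_mull.
  have nR : n%:R = (odd n)%:R :> {poly F2}.
    by rewrite -{1}[n]odd_double_half natrD -muln2 natrM two0 mulr0 addr0.
  rewrite -natr1 nR in pX; move: pA; rewrite /cheb_pair.
  case: odd pX => /=.
    rewrite mul1r -[1 + 1]/2 two0 mul0r addr0 => pV1.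
    by rewrite dvdp_addr.
  by rewrite mul0r !add0r mul1r => pV; rewrite dvdp_addl.
rewrite -size_poly_eq1 -dvdp1 -(cheb_conserved 'X n).
by rewrite dvdp_sub ?dvdp_add ?dvdp_mull // expr2 dvdp_mull.
Qed.

(** The product of all irreducible polynomials of degree at most 2; its square accommodates squares
    of linear ones. *)
Let B : {poly F2} := 'X * ('X - 1%:P) * ('X ^+ 2 + 'X + 1).

Let small_dvdp (g : {poly F2}) : g != 0 -> (size g <= 3)%N -> g %| B ^+ 2.
Proof.
move=> + /poly_size3E gE; rewrite gE /B.
have X1 : 'X ^+ 2 + 1 = ('X - 1%:P) ^+ 2 :> {poly F2}.
  by rewrite polyC1 oppF -[LHS]addr0 -(mul0r 'X) -two0; ring.
have [->|->] := F2P g`_0; have [->|->] := F2P g`_1; have [->|->] := F2P g`_2;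
  rewrite ?polyC0 ?polyC1 ?mul0r ?mul1r ?addr0 ?add0r ?eqxx // => _.
- by rewrite !exprMn -mulrA dvdp_mulIl.
- by rewrite expr2 -!mulrA dvdp_mulIl.
- apply/dvdpP; exists (('X ^+ 2 + 'X + 1) * B).
  by rewrite /B polyC1 oppF; ring.
- by apply: dvd1p.
- by rewrite addrC X1 polyC1 !exprMn -mulrA dvdp_mull // dvdp_mulIl.
- by rewrite addrC oppF expr2 -!mulrA dvdp_mull // dvdp_mulIl.
- have -> : 1 + 'X + 'X ^+ 2 = 'X ^+ 2 + 'X + 1 :> {poly F2} by ring.
  by apply/dvdpP; exists ('X * ('X - 1%:P) * B); rewrite /B; ring.
Qed.

(** Being separable, [cheb_pair n] divides [B]. It is coprime to ['X], so it divides ['X ^+ 3 - 1];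
    for [n = 3] it does not vanish at 1, which leaves too small a degree. *)
Lemma cheb_pair_dvdp_prod n (gs : seq {poly F2}) :
    (forall g, g \in gs -> g != 0 /\ (size g <= 3)%N) ->
  cheb_pair n %| \prod_(g <- gs) g -> (n <= 2)%N.
Proof.
move=> gsP An.
have : cheb_pair n %| B.
  apply: (@separable_dvdp_exp _ _ _ (2 * size gs)).
    exact: separable_cheb_pair.
  apply: dvdp_trans An _; elim: gs gsP => [|g gs IH] gsP.
    by rewrite big_nil muln0 expr0 dvdpp.
  rewrite big_cons mulnS exprD dvdp_mul //.
    by have [] := gsP g (mem_head _ _); apply: small_dvdp.
  by apply: IH => g' gs'; apply: gsP; rewrite inE gs' orbT.
have A0 : coprimep (cheb_pair n) 'X.
  rewrite -['X]subr0 -polyC0 coprimep_XsubC /root horner0_cheb_pair.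
  by rewrite oner_eq0.
rewrite /B -mulrA Gauss_dvdpr // => AB.
have B0 : ('X - 1%:P) * ('X ^+ 2 + 'X + 1) = 'X ^+ 3 - 1 :> {poly F2}.
  by rewrite polyC1; ring.
have nle3 : (n <= 3)%N.
  have := dvdp_leq _ AB; rewrite size_cheb_pair B0 -polyC1 size_XnsubC // ltnS.
  by apply; rewrite -size_poly_eq0 size_XnsubC.
rewrite leq_eqVlt in nle3; case/predU1P: nle3 => [n3|//].
move: AB; rewrite Gauss_dvdpr => [AB|].
  have q3 : size ('X ^+ 2 + 'X + 1 : {poly F2}) = 3%N.
    by rewrite -addrA size_polyDl size_polyXn // -polyC1 size_XaddC.
  have := dvdp_leq _ AB; rewrite size_cheb_pair n3 q3; apply.
  by rewrite -size_poly_eq0 q3.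
rewrite n3 coprimep_XsubC /root /cheb_pair /= !hornerE /=.
by [].
Qed.

Let mod2_eq0 (z : int) : (z%:~R == 0 :> F2) = (2 %| z)%Z.
Proof. by rewrite -(dvdz_pcharf (pchar_Fp (isT : prime 2))). Qed.

(* A factor of degree at most 2 whose reduction is divisible exactly by ['X^a]
   gains a factor 2 for every two missing powers of ['X]; this survives
   multiplication. *)
Let even_part a (g : {poly int}) := forall j, (2 ^+ uphalf (a - j) %| g`_j)%Z.

Let even_partM a b f g : even_part a f -> even_part b g ->
  even_part (a + b) (f * g).
Proof.
move=> fa gb j; rewrite coefM rpred_sum // => -[i /= leij] _.
apply: dvdz_trans (dvdz_mul (fa i) (gb (j - i)%N)).
rewrite -exprD dvdz_exp2l // !uphalf_half.
have := leq_half_double; lia.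
Qed.

Let small_even_part (g : {poly int}) : mod2 g != 0 -> (size g <= 3)%N ->
  exists a h, [/\ mod2 g = 'X ^+ a * h, h.[0] != 0 & even_part a g].
Proof.
move=> gn0 g3; have /poly_size3E gE : (size (mod2 g) <= 3)%N.
  exact: leq_trans (size_poly _ _) g3.
rewrite !coef_map /= in gE.
have [g0|g0] := boolP (2 %| g`_0)%Z; last first.
  exists 0%N, (mod2 g); rewrite mul1r horner_coef0 coef_map mod2_eq0.
  by split=> // j; rewrite sub0n expr0 dvd1z.
have [g1|g1] := boolP (2 %| g`_1)%Z; last first.
  exists 1%N, ((g`_1)%:~R%:P + (g`_2)%:~R%:P * 'X); split.
  - by rewrite gE; move: g0; rewrite -mod2_eq0 => /eqP->; ring.
  - by rewrite !hornerE mod2_eq0.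
  by case=> [|j] /=; rewrite ?subnn ?expr1 // ?expr0 ?dvd1z.
exists 2, (g`_2)%:~R%:P; move: (g0) (g1); rewrite -!mod2_eq0 => /eqP h0 /eqP h1.
rewrite h0 h1 !mul0r !add0r in gE; split.
- by rewrite gE mulrC.
- by rewrite hornerC; apply: contraNneq gn0 => h2; rewrite gE h2 mul0r.
by case=> [|[|j]] //=; rewrite expr0 dvd1z.
Qed.

(** The exact powers of ['X] in the reduced factors add up to at least [al], and [even_part] is
    multiplicative. *)
Lemma dvdz_coef_prod (fs : seq {poly int}) al :
    (forall g, g \in fs -> mod2 g != 0 /\ (size g <= 3)%N) ->
    'X ^+ al %| mod2 (\prod_(g <- fs) g) ->
  forall j, (2 ^+ uphalf (al - j) %| (\prod_(g <- fs) g)`_j)%Z.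
Proof.
move=> fsP alf; have [a [h [fE h0 fa]]] : exists a h,
    [/\ mod2 (\prod_(g <- fs) g) = 'X ^+ a * h, h.[0] != 0 &
      even_part a (\prod_(g <- fs) g)].
  elim: fs fsP {alf} => [|g fs IH] fsP.
    exists 0%N, 1; rewrite big_nil rmorph1 mul1r hornerC oner_eq0.
    by split=> // j; rewrite sub0n expr0 dvd1z.
  have [|a [h [fE h0 fa]]] := IH.
    by move=> g' gs'; apply: fsP; rewrite inE gs' orbT.
  have [gn0 g3] := fsP g (mem_head _ _).
  have [b [l [gE l0 gb]]] := small_even_part gn0 g3.
  exists (b + a)%N, (l * h); rewrite big_cons rmorphM /= gE fE hornerM mulf_neq0 //.
  by split=> //; [rewrite exprD; ring | apply: even_partM].
have leal : (al <= a)%N.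
  have X1 : (1 < size ('X : {poly F2}))%N by rewrite size_polyX.
  rewrite -(dvdp_Pexp2l al a X1); move: alf; rewrite fE Gauss_dvdpl //.
  rewrite coprimep_expl // coprimep_sym -['X]subr0 -polyC0 coprimep_XsubC.
  by rewrite /root.
move=> j; apply: dvdz_trans (fa j); rewrite dvdz_exp2l // uphalf_leq //.
by rewrite leq_sub2r.
Qed.

(** A lift of the irreducible quadratic over ['F_2], with signs chosen so that it divides
    [cheb 'X 5] over the integers. *)
Local Notation gold := ('X ^+ 2 + 'X - 1).

Let mod2_gold : mod2 gold = 'X ^+ 2 + 'X - 1.
Proof. by rewrite !(rmorphB, rmorphD, rmorphXn) /= map_polyX rmorph1. Qed.

Let size_gold (R : nzRingType) : size (gold : {poly R}) = 3%N.
Proof.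
by rewrite -addrA size_polyDl size_polyXn // -polyC1 size_XsubC.
Qed.

Let gold_irreducible : irreducible_poly (gold : {poly F2}).
Proof.
apply: cubic_irreducible; first by rewrite size_gold.
by move=> z; have [->|->] := F2P z; rewrite /root !hornerE /=.
Qed.

Let mod2_eq0_poly (p : {poly int}) : mod2 p = 0 -> exists r, p = 2 * r.
Proof.
move=> p0; have /polyOver_dvdzP[r ->] : p \is a polyOver (dvdz 2).
  by apply/polyOverP => i; rewrite -[_ \in _]mod2_eq0 -coef_map p0 coef0.
by exists r; rewrite -mul_polyC -[2]/(2%:R) polyC_natr.
Qed.

(* The factors divisible by the irreducible quadratic modulo 2 are equal to it
   modulo 2, so the product lies in a power of the ideal generated by 2 and
   that quadratic. *)
Let gold_part m (f : {poly int}) := if m is l.+1 then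
  exists a b c, f = 2 ^+ l.+1 * a + 2 ^+ l * gold * b + gold ^+ 2 * c else True.

Lemma gold_or_coprime (g : {poly int}) : mod2 g != 0 -> (size g <= 3)%N ->
  (exists r, g = gold + 2 * r) \/ coprimep (mod2 g) gold.
Proof.
move=> gn0 g3; have [irr1 irr] := gold_irreducible.
have [co|nco] := boolP (coprimep (mod2 g) gold); [by right | left].
have := irr _ nco (dvdp_gcdr _ _).
rewrite /eqp => /andP[_ gold_d].
have : gold %| mod2 g by apply: dvdp_trans gold_d (dvdp_gcdl _ _).
move=> dg; have : gold %= mod2 g.
  rewrite -dvdp_size_eqp // eqn_leq dvdp_leq //= size_gold.
  exact: leq_trans (size_poly _ _) g3.
case/eqpf_eq => z z0 gE.
have [r rE] : exists r, g - gold = 2 * r.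
  apply: mod2_eq0_poly; rewrite rmorphB /= mod2_gold gE.
  by have [z1|->] := F2P z; [rewrite z1 eqxx in z0 | rewrite scale1r subrr].
by exists r; rewrite -rE; ring.
Qed.

(** At least [m.+1] factors lie in the ideal (2, gold), and the power [m.+1] of this ideal is
    contained in (2^m, gold^2). *)
Lemma gold_prod (fs : seq {poly int}) m :
    (forall g, g \in fs -> mod2 g != 0 /\ (size g <= 3)%N) ->
    gold ^+ m.+1 %| mod2 (\prod_(g <- fs) g) ->
  exists a b, \prod_(g <- fs) g = 2 ^+ m * a + gold ^+ 2 * b.
Proof.
move=> fsP mf; have [l [h [fE h0 fl]]] : exists l h,
    [/\ mod2 (\prod_(g <- fs) g) = gold ^+ l * h, coprimep h gold &
      gold_part l (\prod_(g <- fs) g)].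
  elim: fs fsP {mf} => [|g fs IH] fsP.
    by exists 0%N, 1; rewrite big_nil rmorph1 expr0 mul1r coprime1p.
  have [|l [h [fE h0 fl]]] := IH.
    by move=> g' gs'; apply: fsP; rewrite inE gs' orbT.
  have [gn0 g3] := fsP g (mem_head _ _).
  rewrite big_cons; set f := \prod_(_ <- fs) _ in fE fl *.
  have [[r gE]|co] := gold_or_coprime gn0 g3; last first.
    exists l, (mod2 g * h); split.
    - by rewrite rmorphM /= fE; ring.
    - by rewrite coprimepMl co.
    case: l fl {fE} => // l [a [b [c ->]]].
    by exists (a * g), (b * g), (c * g); ring.
  exists l.+1, h; split=> //.
    rewrite rmorphM /= fE gE rmorphD rmorphM /= mod2_gold.
    by rewrite rmorph_nat two0 mul0r addr0 [gold ^+ l.+1]exprS; ring.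
  rewrite gE; case: l fl {fE} => [_|l [a [b [c ->]]]].
    by exists (r * f), f, 0; ring.
  exists (a * r), (a + b * r), (2 ^+ l * b + c * (gold + 2 * r)).
  by rewrite [2 ^+ l.+2]exprS [2 ^+ l.+1]exprS; ring.
have : (m.+1 <= l)%N.
  have g1 : (1 < size (gold : {poly F2}))%N by rewrite size_gold.
  rewrite -(dvdp_Pexp2l m.+1 l g1); move: mf; rewrite fE Gauss_dvdpl //.
  by rewrite coprimep_expl // coprimep_sym.
case: l fl {fE} => // l [a [b [c ->]]] leml.
exists (2 ^+ (l - m) * (2 * a + gold * b)), c.
rewrite ltnS in leml; rewrite [2 ^+ l.+1]exprS.
by have -> : 2 ^+ l = 2 ^+ m * 2 ^+ (l - m) :> {poly int};
  [rewrite -exprD subnKC | ring].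
Qed.

End ModTwo.

(** * Excluding large diameters *)

Lemma cheb_at0 (R : comNzRingType) n :
  cheb (0 : R) n.*2 = 0 /\ cheb (0 : R) n.*2.+1 = (-1) ^+ n.
Proof.
elim: n => [//|n [IH0 IH1]].
have E : cheb (0 : R) n.+1.*2 = 0 by rewrite doubleS chebSS mul0r IH0 subr0.
by split=> //; rewrite chebSS mul0r IH1 exprS; ring.
Qed.

Lemma cheb_atN2 (R : comNzRingType) n :
  cheb (- 2 : R) n = (-1) ^+ n.+1 * n%:R.
Proof.
suff [] : cheb (- 2 : R) n = (-1) ^+ n.+1 * n%:R /\
   cheb (- 2 : R) n.+1 = (-1) ^+ n.+2 * n.+1%:R by [].
elim: n => [|n [IH0 IH1]]; first by rewrite /=; split; ring.
by split=> //; rewrite chebSS IH1 IH0 !exprS -!natr1; ring.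
Qed.

Lemma horner_cheb (R : comNzRingType) (x : R) n :
  (cheb 'X n : {poly R}).[x] = cheb x n.
Proof.
by rewrite -[LHS]/(horner_eval x _) rmorph_cheb /= /horner_eval hornerX.
Qed.

Lemma coef1_comp_XaddC (R : comNzRingType) (p : {poly R}) c :
  (p \Po ('X + c%:P))`_1 = p^`().[c].
Proof.
have /(congr1 (fun q => q.[0])) := deriv_comp p ('X + c%:P).
rewrite derivD derivX derivC addr0 mulr1 horner_comp !hornerE.
by rewrite horner_coef0 coef_deriv mulr1n.
Qed.

Lemma coef0_comp_XaddC (R : comNzRingType) (p : {poly R}) c :
  (p \Po ('X + c%:P))`_0 = p.[c].
Proof. by rewrite -horner_coef0 horner_comp !hornerE. Qed.

(** After [a] is reduced modulo [h], [p - N%:P * a2] is a multiple of [h] of smaller degree, hence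
    zero. *)
Lemma monic_dvd_coef (N : int) (h p a s : {poly int}) :
    h \is monic -> (size p < size h)%N -> p = N%:P * a + h * s ->
  forall i, (N %| p`_i)%Z.
Proof.
move=> mh ph pE i.
have aE := Pdiv.IdomainMonic.divp_eq mh a.
set a1 := a %/ h in aE; set a2 := a %% h in aE.
have a2h : (size a2 < size h)%N by rewrite ltn_modp monic_neq0.
have E : p - N%:P * a2 = (s + N%:P * a1) * h by rewrite pE aE; ring.
have lt_h : (size (p - N%:P * a2)%R < size h)%N.
  rewrite (leq_ltn_trans (size_polyD _ _)) // gtn_max ph size_polyN.
  by rewrite (leq_ltn_trans _ a2h) // mul_polyC size_scale_leq.
have s0 : s + N%:P * a1 = 0.
  apply/eqP; apply: contraTT lt_h => sn0; rewrite -leqNgt E size_Mmonic //.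
  rewrite -size_poly_gt0 in sn0; case: (size (s + _)) sn0 => // l _.
  by rewrite addSn leq_addl.
move/eqP: E; rewrite s0 mul0r subr_eq0 => /eqP->.
by rewrite coefCM dvdz_mulr.
Qed.

Lemma odd_part_ex L : (0 < L)%N -> exists b r, L = (2 ^ b * r.*2.+1)%N.
Proof.
have [m] := ubnP L; elim: m L => // m IHm L ltLm L0.
have [oL|eL] := boolP (odd L).
  by exists 0%N, L./2; rewrite mul1n -{1}[L]odd_double_half oL.
have LE : L = L./2.*2 by rewrite -{1}[L]odd_double_half (negPf eL).
have [||b [r bE]] := IHm L./2; try lia.
by exists b.+1, r; rewrite LE bE expnS -mulnA mul2n.
Qed.

Section LargeDiameter.
Local Notation gold := ('X ^+ 2 + 'X - 1).
Local Notation mod2 := (map_poly (intr : int -> 'F_2)).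
Local Notation V := (@cheb {poly int} 'X).

Let gold_monic : gold \is @monic int.
Proof.
rewrite -addrA monicE lead_coefDl ?lead_coefXn //.
by rewrite size_polyXn -polyC1 size_XsubC.
Qed.

Let size_gold : size (gold : {poly int}) = 3%N.
Proof. by rewrite -addrA size_polyDl size_polyXn // -polyC1 size_XsubC. Qed.

(** Two doublings starting from [V 4] and [V 5]. What matters is [V 10] and [V 20] modulo gold^2,
    and [V 9] and [V 19] modulo gold. *)
Let cheb_gold : exists c9 e9 c10 c19 e19 c20 : {poly int},
  [/\ V 9 = gold ^+ 2 * c9 + gold * e9 - 1, V 10 = gold ^+ 2 * c10 - 4 * 'X * gold,
      V 19 = gold ^+ 2 * c19 + gold * e19 - 1 &
      V 20 = gold ^+ 2 * c20 - 8 * 'X * gold].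
Proof.
have V4 : V 4 = gold * ('X - 1) - 1 by rewrite /=; ring.
have V5 : V 5 = gold ^+ 2 - 2 * 'X * gold by rewrite /=; ring.
have [] : V 9 = V 5 ^+ 2 - V 4 ^+ 2 /\ V 10 = 'X * V 5 ^+ 2 - 2 * V 5 * V 4.
  exact: (cheb_doubleS 'X 4%N).
have [] : V 19 = V 10 ^+ 2 - V 9 ^+ 2 /\ V 20 = 'X * V 10 ^+ 2 - 2 * V 10 * V 9.
  exact: (cheb_doubleS 'X 9%N).
rewrite V4 V5 => V19 V20 V9 V10.
pose c9 : {poly int} := (gold - 2 * 'X) ^+ 2 - ('X - 1) ^+ 2.
pose c10 : {poly int} := 'X * (gold - 2 * 'X) ^+ 2
  - 2 * (gold * ('X - 1) - 1) + 4 * 'X * ('X - 1).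
have {}V9 : V 9 = gold ^+ 2 * c9 + gold * (2 * ('X - 1)) - 1.
  by rewrite V9 /c9; ring.
have {}V10 : V 10 = gold ^+ 2 * c10 - 4 * 'X * gold.
  by rewrite V10 /c10; ring.
rewrite V9 V10 in V19 V20.
pose d9 := gold * c9 + 2 * ('X - 1); pose d10 := gold * c10 - 4 * 'X.
exists c9, (2 * ('X - 1)), c10, (d10 ^+ 2 - d9 ^+ 2 + 2 * c9), (4 * ('X - 1)),
  ('X * d10 ^+ 2 - 2 * (d10 * d9) + 2 * c10).
split=> //.
  rewrite V19 /d9 /d10; move: c9 c10 {V9 V10 V19 V20 d9 d10} => c9 c10; ring.
by rewrite V20 /d9 /d10; move: c9 c10 {V9 V10 V19 V20 d9 d10} => c9 c10; ring.
Qed.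

(** Modulo gold the two expressions for [f] give that [2 * N] divides [be]. The terms left modulo
    gold^2 are multiples of [N] and gold, and cancelling these shows that [g1 * 'X + g0] is even. *)
Lemma gold_parity (N g1 g0 be : int) (f a b c c' e VL VL1 : {poly int}) :
    N != 0 -> VL = gold ^+ 2 * c - N%:P * 'X * gold ->
    VL1 = gold ^+ 2 * c' + gold * e - 1 ->
    f = (g1%:P * 'X + g0%:P) * VL + be%:P * VL1 ->
    f = (2 * N)%:P * a + gold ^+ 2 * b ->
  (2 %| g1)%Z && (2 %| g0)%Z.
Proof.
move=> N0 VLE VL1E fE fE'.
have : (2 * N %| be)%Z.
  have := @monic_dvd_coef (2 * N) gold be%:P (- a)
    ((g1%:P * 'X + g0%:P) * (gold * c - N%:P * 'X) + be%:P * (gold * c' + e)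
     - gold * b) gold_monic.
  rewrite size_gold ltnS (leq_trans (size_polyC_leq1 _)) //.
  move=> /(_ isT) H; have := H _ 0%N; rewrite coefC /=; apply.
  have : (g1%:P * 'X + g0%:P) * VL + be%:P * VL1 =
    (2 * N)%:P * a + gold ^+ 2 * b by rewrite -fE.
  rewrite VLE VL1E => E.
  apply/eqP; rewrite -subr_eq0; apply/eqP.
  move/eqP: E; rewrite -subr_eq0 => /eqP E.
  by rewrite -[RHS]oppr0 -E; ring.
case/dvdzP => be' beE.
have gold2_monic : gold ^+ 2 \is @monic int by rewrite monic_exp.
(* The remainder of [- N * 'X * (g1 * 'X + g0)] modulo gold, where ['X ^+ 2] becomes [1 - 'X]. *)
pose p1 : {poly int} := - N%:P * (g1%:P + (g0 - g1)%:P * 'X).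
have p1E : gold * p1 = (2 * N)%:P * (a - be'%:P * VL1) +
   gold ^+ 2 * (b - (g1%:P * 'X + g0%:P) * c + N%:P * g1%:P).
  move/eqP: fE'; rewrite fE VLE -subr_eq0 => /eqP E.
  apply/eqP; rewrite -subr_eq0 -E beE /p1 polyCB !polyCM; apply/eqP.
  ring.
pose a0 := - N * g1; pose a1 := - N * (g0 - g1).
have {}p1E : a1%:P * 'X ^+ 3 + (a0 + a1)%:P * 'X ^+ 2 + (a0 - a1)%:P * 'X
    + (- a0)%:P = (2 * N)%:P * (a - be'%:P * VL1) +
   gold ^+ 2 * (b - (g1%:P * 'X + g0%:P) * c + N%:P * g1%:P).
  rewrite -p1E /p1 polyCD polyCB polyCN /a1 /a0 !polyCM polyCN; ring.
have size_p : (size (a1%:P * 'X ^+ 3 + (a0 + a1)%:P * 'X ^+ 2 +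
    (a0 - a1)%:P * 'X + (- a0)%:P)%R < size (gold ^+ 2 : {poly int}))%N.
  rewrite [gold ^+ 2]expr2 size_Mmonic ?monic_neq0 // size_gold ltnS; apply/leq_sizeP.
  move=> [|[|[|[|j]]]] // _.
  by rewrite !(coefD, coefCM, coefXn, coefC, coefX) /= !mulr0.
have dvd_i := monic_dvd_coef gold2_monic size_p p1E.
have := dvd_i 0%N; have := dvd_i 3.
rewrite !(coefD, coefCM, coefXn, coefC, coefX) /= !(mulr0, mulr1, addr0, add0r).
rewrite /a1 /a0 !mulNr opprK rpredN ![2 * N]mulrC !dvdz_mul2l // => h1 h0.
by apply/andP; split=> //; rewrite -(subrK g1 g0) rpredD.
Qed.

Section Factors.
Variables (fs : seq {poly int}) (L : nat) (g1 g0 be : int).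
Let f := \prod_(g <- fs) g.
Hypothesis fs3 : forall g, g \in fs -> (size g <= 3)%N.
Hypothesis fE : f = (g1%:P * 'X + g0%:P) * V L + be%:P * V L.-1.
Hypotheses (L0 : (0 < L)%N) (be2 : (2 %| be)%Z).
(** Modulo 2, [f] is [V L] in the first case and ['X * V L] in the second, where moreover
    [g1 * x + g0] takes the value [be] at -2. *)
Hypothesis g01 : (2 %| g1)%Z /\ ~~ (2 %| g0)%Z \/
                 ~~ (2 %| g1)%Z /\ g0 = 2 * g1 + be.

Let mod2_0 (z : int) : (2 %| z)%Z -> z%:~R = 0 :> 'F_2.
Proof. by rewrite (dvdz_pcharf (pchar_Fp (isT : prime 2))) => /eqP. Qed.

Let mod2_1 (z : int) : ~~ (2 %| z)%Z -> z%:~R = 1 :> 'F_2.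
Proof.
rewrite (dvdz_pcharf (pchar_Fp (isT : prime 2))).
by case: (z%:~R) => [[|[|//]] ?] z0; apply: val_inj.
Qed.

Let eps : nat := ~~ (2 %| g1)%Z.

Lemma mod2_factors : mod2 f = 'X ^+ eps * @cheb {poly 'F_2} 'X L.
Proof.
rewrite fE rmorphD !rmorphM rmorphD rmorphM /= map_polyX !map_polyC /=.
rewrite !rmorph_cheb /= map_polyX (mod2_0 be2) mul0r addr0 /eps.
case: g01 => [[/[dup] + /mod2_0-> /mod2_1->]|[/[dup] + /mod2_1-> g0E]] => ->.
  by rewrite mul0r add0r expr0.
by rewrite g0E mod2_0 ?addr0 ?mul1r ?expr1 // rpredD // dvdz_mulr.
Qed.

Let V2_neq0 n : (0 < n)%N -> @cheb {poly 'F_2} 'X n != 0.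
Proof.
case: n => // n _; apply: contraTneq isT => V0.
by have := (size_cheb 'F_2 n).2; rewrite V0 coef0.
Qed.

Lemma mod2_factors_small g : g \in fs -> mod2 g != 0 /\ (size g <= 3)%N.
Proof.
move=> gfs; split; last exact: fs3.
have : mod2 f != 0.
  by rewrite mod2_factors mulf_neq0 ?V2_neq0 // expf_neq0 // polyX_eq0.
rewrite /f rmorph_prod prodf_seq_neq0 => /allP/(_ g gfs).
by [].
Qed.

Let comp_prod c : f \Po ('X + c%:P) =
  \prod_(g <- [seq g \Po ('X + c%:P) | g <- fs]) g.
Proof. by rewrite big_map /f rmorph_prod. Qed.

Let mod2_comp (p : {poly int}) c :
  mod2 (p \Po ('X + c%:P)) = mod2 p \Po ('X + c%:~R%:P).
Proof. by rewrite map_comp_poly rmorphD /= map_polyX map_polyC. Qed.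

Let dvdz_coef_shift c al : ('X - c%:~R%:P) ^+ al %| mod2 f ->
  forall j, (2 ^+ uphalf (al - j) %| (f \Po ('X + c%:P))`_j)%Z.
Proof.
move=> cf; rewrite comp_prod; apply: dvdz_coef_prod.
  move=> _ /mapP[g gfs ->]; have [g0' g3] := mod2_factors_small gfs.
  rewrite size_comp_poly2 ?size_XaddC // mod2_comp; split=> //.
  by rewrite comp_poly_eq0 // size_XaddC.
rewrite -comp_prod mod2_comp; case/dvdpP: cf => r ->.
rewrite rmorphM rmorphXn /= comp_polyB comp_polyX comp_polyC addrK.
exact: dvdp_mulIr.
Qed.

(** If [r.*2.+1] is the odd part of [L], then [cheb_pair r] divides [f] modulo 2, so [r <= 2]. *)
Lemma cheb_index_form : exists b m, L = (2 ^ b * m)%N /\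
   (m = 1 \/ m = 3 \/ m = 5)%N.
Proof.
have [b [r LE]] := odd_part_ex L0; exists b, r.*2.+1; split=> //.
have : (r <= 2)%N.
  apply: (@cheb_pair_dvdp_prod _ (map mod2 fs)).
    move=> _ /mapP[g gfs ->]; have [g0' g3] := mod2_factors_small gfs.
    by split=> //; apply: leq_trans (size_poly _ _) g3.
  rewrite big_map -rmorph_prod /= mod2_factors LE cheb_mod2_pow2.
  rewrite cheb_mod2_odd -exprM mulrA dvdp_mull //.
  by rewrite -{1}[cheb_pair r]expr1 dvdp_exp2l // muln_gt0 expn_gt0.
by case: r {LE} => [|[|[|r]]] // _; [left | right; left | right; right].
Qed.

Let horner_f x :
  f.[x] = (g1 * x + g0) * cheb x L + be * cheb x L.-1.
Proof. by rewrite fE !hornerE !horner_cheb. Qed.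

Let horner_f' x : f^`().[x] = g1 * cheb x L +
  (g1 * x + g0) * (V L)^`().[x] + be * (V L.-1)^`().[x].
Proof.
by rewrite fE !derivE !hornerE !horner_cheb; ring.
Qed.

Let dvdz_pow2 E b m z : (2 ^+ E %| z * (2 ^ b * m)%N%:Z)%Z ->
  ~~ (2 %| z)%Z -> odd m -> (E <= b)%N.
Proof.
move=> dz oz om; have : (2 ^ E %| 2 ^ b)%N; last by rewrite dvdn_Pexp2l.
have cz : coprime (2 ^ E) `|z * m%:Z|.
  rewrite coprimeXl // prime_coprime // abszM Euclid_dvdM // negb_or.
  by rewrite -[(2 %| `|m%:Z|)%N]/(2 %| m)%N [(2 %| m)%N]dvdn2 om andbT.
rewrite -(Gauss_dvdr _ cz) abszM -mulnA [(_ * 2 ^ b)%N]mulnC.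
by move: dz; rewrite dvdzE abszM abszX.
Qed.

(** The value of [f] at 0 is [be] up to sign, so [2 ^+ E] divides [be]. Since [V L] is [- L] at -2,
    [f] or its derivative there makes [2 ^+ E] divide an odd multiple of [L], whose 2-adic valuation
    is only [b.+3]. *)
Let no_pow8 b m : L = (2 ^ b.+3 * m)%N -> odd m -> False.
Proof.
move=> LE om; pose E := (2 ^ b.+2)%N.
have dX : 'X ^+ (2 ^ b.+3).-1 %| @cheb {poly 'F_2} 'X L.
  by rewrite LE cheb_mod2_pow2 dvdp_mulIl.
have E0 : (0 < E)%N by rewrite expn_gt0.
have E2 : (2 ^ b.+3 = E.*2)%N by rewrite expnS mul2n.
have upE : uphalf (2 ^ b.+3).-1 = E.
  by rewrite E2; case: (E) E0 => // l _; rewrite doubleS /= doubleK.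
have LE2 : L = (2 ^ b.+2 * m)%N.*2 by rewrite LE expnS -mulnA mul2n.
have L1E : L.-1 = (2 ^ b.+2 * m)%N.-1.*2.+1.
  rewrite LE2; have : (0 < 2 ^ b.+2 * m)%N.
    by rewrite -double_gt0 -LE2.
  by case: (2 ^ b.+2 * m)%N.
have be_dvd : (2 ^+ E %| be)%Z.
  have := @dvdz_coef_shift 0 (2 ^ b.+3).-1.
  rewrite rmorph0 subr0 mod2_factors => /(_ (dvdp_mull _ dX) 0%N).
  rewrite subn0 upE coef0_comp_XaddC horner_f mulr0 add0r.
  rewrite {1}LE2 L1E (cheb_at0 _ _).1 (cheb_at0 _ _).2 mulr0 add0r.
  by rewrite -signr_odd; case: odd; rewrite ?expr1 ?mulrN1 ?rpredN ?mulr1.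
have be_mul x : (2 ^+ E %| be * x)%Z by exact: dvdz_mulr.
have dN2 al : ('X ^+ al %| mod2 f) -> forall j,
    (2 ^+ uphalf (al - j) %| (f \Po ('X + (- 2)%:P))`_j)%Z.
  move=> alf; apply: dvdz_coef_shift.
  by rewrite mod2_0 ?subr0 // dvdzN.
have VN2 : cheb (- 2) L = - L%:Z.
  by rewrite cheb_atN2 exprS LE2 -mul2n exprM sqrrN !expr1n mulr1 mulN1r natz.
suff [z oz dz] : exists2 z, ~~ (2 %| z)%Z & (2 ^+ E %| z * L%:Z)%Z.
  rewrite LE in dz; have := dvdz_pow2 dz oz om.
  by rewrite /E !expnS; have := ltn_expl b (isT : 1 < 2)%N; lia.
case: g01 => [[g1e g0o]|[g1o g0E]].
  exists (g0 - 2 * g1); first by rewrite rpredBr // dvdz_mulr.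
  have := dN2 (2 ^ b.+3).-1; rewrite mod2_factors dvdp_mull // => /(_ isT 0%N).
  rewrite subn0 upE coef0_comp_XaddC horner_f VN2 rpredDr ?be_mul //.
  have -> : (g1 * - 2 + g0) * - L%:Z = - ((g0 - 2 * g1) * L%:Z) by ring.
  by rewrite rpredN.
(* Here [f] at -2 is a multiple of [be] and says nothing about [L]. The extra factor ['X] modulo 2
   makes up for passing to the coefficient of index 1. *)
exists g1 => //; have := dN2 (2 ^ b.+3)%N; rewrite mod2_factors.
have -> : eps = 1%N by rewrite /eps g1o.
have -> : (2 ^ b.+3 = 1 + (2 ^ b.+3).-1)%N by rewrite add1n prednK ?expn_gt0.
rewrite exprD dvdp_mul // => /(_ isT 1%N).
rewrite addKn upE coef1_comp_XaddC horner_f' VN2 rpredDr ?be_mul //.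
have -> : g1 * - 2 + g0 = be by rewrite g0E; ring.
by rewrite rpredDr ?be_mul // mulrN rpredN.
Qed.

(** Modulo 2, ['X - 1] has exponent at least 8 in [V 12]. The value at -1 gives that 16 divides
    [be]; the derivative there, [8 * (g1 - g0)] up to multiples of [be], then forces [g1 - g0] to be
    even. *)
Let no_12 : L <> 12%N.
Proof.
move=> LE; have LE4 : L = (2 ^ 2 * 1.*2.+1)%N by rewrite LE.
have V12 : cheb (-1 : int) 12 = 0 by vm_compute.
have V13 : cheb (-1 : int) 13 = 1 by vm_compute.
have V11 : cheb (-1 : int) 11 = -1 by vm_compute.
have dX : ('X - 1) ^+ 8 %| @cheb {poly 'F_2} 'X L.
  rewrite LE4 cheb_mod2_pow2 cheb_mod2_odd -exprM.
  have -> : cheb_pair 1 = 'X - 1.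
    rewrite /cheb_pair /= mulr1 subr0; congr (_ + _).
    by rewrite -polyC1 -polyCN; congr _%:P; apply: val_inj.
  exact: dvdp_mulIr.
have dN1 j : (2 ^+ uphalf (8 - j) %| (f \Po ('X + (-1)%:P))`_j)%Z.
  apply: dvdz_coef_shift; rewrite mod2_factors mod2_1 // polyC1.
  exact: dvdp_mull.
have V12' : (V L)^`().[-1] = - 8 :> int.
  have /(congr1 (fun p => p.[-1])) := deriv_cheb int L.
  rewrite !(hornerD, hornerN, hornerM, horner_cheb, hornerX, hornerXn).
  rewrite -!polyC_natr !hornerC LE V12 V13 => E.
  by apply: (@mulfI _ (- 3)) => //; rewrite -[RHS]E; ring.
have be16 : (16 %| be)%Z.
  have := dN1 0%N; rewrite coef0_comp_XaddC horner_f LE V12 V11.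
  by rewrite mulr0 add0r mulrN1 rpredN.
have := dN1 1%N; rewrite coef1_comp_XaddC horner_f' V12'.
have be_mul x : (2 ^+ uphalf (8 - 1) %| be * x)%Z by exact: dvdz_mulr.
rewrite {1}LE V12 mulr0 add0r rpredDr ?be_mul //.
have -> : (g1 * -1 + g0) * - 8 = 8 * (g1 - g0) by ring.
have -> : 2 ^+ uphalf (8 - 1) = 8 * 2 :> int by [].
rewrite dvdz_mul2l // => g_even.
case: g01 => [[g1e /negP[]]|[/negP g1o g0E]].
  by rewrite -(subKr g1 g0) rpredB.
by case: g1o; rewrite -(subrK g0 g1) rpredD // g0E rpredD // dvdz_mulr.
Qed.

(** [gold_prod] puts [f] in the ideal required by [gold_parity], so [g1] and [g0] would both be
    even. *)
Let no_gold (N : int) c c' e mu : N != 0 ->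
    V L = gold ^+ 2 * c - N%:P * 'X * gold ->
    V L.-1 = gold ^+ 2 * c' + gold * e - 1 ->
    2 * N = 2 ^+ mu ->
    ('X ^+ 2 + 'X - 1) ^+ mu.+1 %| @cheb {poly 'F_2} 'X L -> False.
Proof.
move=> N0 VL VL1 NE dX.
have [|a [b ab]] := @gold_prod fs mu mod2_factors_small.
  by rewrite -/f mod2_factors dvdp_mull.
have := @gold_parity N g1 g0 be f a b c c' e _ _ N0 VL VL1 fE.
have -> : (2 * N)%:P = 2 ^+ mu :> {poly int}.
  by rewrite NE rmorphXn /= -polyC_natr.
move=> /(_ ab)/andP[g1e g0e].
by case: g01 => [[_ /negP]|[/negP]].
Qed.

Let cheb_pair2 : cheb_pair 2 = 'X ^+ 2 + 'X - 1.
Proof. by rewrite /cheb_pair /=; ring. Qed.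

Let no_10 : L <> 10%N.
Proof.
move=> LE; have LE2 : L = (2 ^ 1 * 2.*2.+1)%N by rewrite LE.
have [c9 [e9 [c10 [_ [_ [_ [V9 V10 _ _]]]]]]] := cheb_gold.
apply: (@no_gold 4 c10 c9 e9 3) => //; try by rewrite LE.
  by rewrite LE V10 -[4]/(4%:R) polyC_natr.
rewrite LE2 cheb_mod2_pow2 cheb_mod2_odd -exprM cheb_pair2.
exact: dvdp_mull.
Qed.

Let no_20 : L <> 20%N.
Proof.
move=> LE; have LE2 : L = (2 ^ 2 * 2.*2.+1)%N by rewrite LE.
have [_ [_ [_ [c19 [e19 [c20 [_ _ V19 V20]]]]]]] := cheb_gold.
apply: (@no_gold 8 c20 c19 e19 4) => //; try by rewrite LE.
  by rewrite LE V20 -[8]/(8%:R) polyC_natr.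
rewrite LE2 cheb_mod2_pow2 cheb_mod2_odd -exprM cheb_pair2.
by apply: dvdp_mull; rewrite dvdp_exp2l.
Qed.

(** With 8 not dividing [L], the possible values above 6 are 10, 12 and 20. *)
Lemma factors_small_index : (L <= 6)%N.
Proof.
rewrite leqNgt; apply/negP => L6.
have [b [m [LE mE]]] := cheb_index_form.
have om : odd m by case: mE => [->|[->|->]].
case: b LE => [|[|[|b]]] LE; last exact: no_pow8 LE om.
- by move: L6; rewrite LE mul1n; case: mE => [->|[->|->]].
- case: mE L6 LE => [->|[->|->]] L6 LE; last exact: no_10 LE.
    by rewrite LE in L6.
  by rewrite LE in L6.
case: mE L6 LE => [->|[->|->]] L6 LE; first by rewrite LE in L6.
  exact: no_12 LE.
exact: no_20 LE.
Qed.

End Factors.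
End LargeDiameter.

Lemma half_chebE (R : pzRingType) (x : R) h :
  half_cheb x h.*2 = cheb x h /\ half_cheb x h.*2.+1 = cheb x h.+1 + cheb x h.
Proof.
by rewrite /half_cheb oddS odd_double doubleK (half_bit_double h true).
Qed.

(** * Bounds on the diameter in each parity *)

Section Parity.
Local Notation mod2 := (map_poly (intr : int -> 'F_2)).
Local Notation V := (@cheb {poly int} 'X).
Variables (w u : int) (n : nat) (fs : seq {poly int}).
Hypothesis fs3 : forall g, g \in fs -> (size g <= 3)%N.
Hypothesis fE : char_factor w u n = \prod_(g <- fs) g.
Hypothesis wu : ~ ((2 %| w)%Z /\ (2 %| u)%Z).

Let mod2_0 (z : int) : (2 %| z)%Z -> mod2 z%:P = 0.
Proof.
by rewrite (dvdz_pcharf (pchar_Fp (isT : prime 2))) map_polyC => /eqP /= ->.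
Qed.

Let mod2_1 (z : int) : ~~ (2 %| z)%Z -> mod2 z%:P = 1.
Proof.
rewrite (dvdz_pcharf (pchar_Fp (isT : prime 2))) map_polyC /=.
by case: (z%:~R) => [[|[|//]] ?] z0; rewrite -polyC1; congr _%:P; apply: val_inj.
Qed.

Let mod2D (p q : {poly int}) : mod2 (p + q) = mod2 p + mod2 q.
Proof. exact: rmorphD. Qed.

Let mod2_pair i : mod2 (V i.+1 + V i) = cheb_pair i.
Proof. by rewrite (mod2D (V i.+1) (V i)) !mod2_cheb. Qed.

Let mod2_lin (a b : int) (p q : {poly int}) :
  mod2 (a%:P * p + b%:P * q) = mod2 a%:P * mod2 p + mod2 b%:P * mod2 q.
Proof. by rewrite rmorphD !rmorphM. Qed.

Let cheb_pair_le2 r : mod2 (char_factor w u n) = cheb_pair r -> (r <= 2)%N.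
Proof.
rewrite fE => E; have f0 : mod2 (\prod_(g <- fs) g) != 0.
  by rewrite E -size_poly_eq0 size_cheb_pair.
apply: (@cheb_pair_dvdp_prod _ (map mod2 fs)).
  move=> _ /mapP[g gfs ->]; split; last exact: leq_trans (size_poly _ _) (fs3 gfs).
  by move: f0; rewrite rmorph_prod prodf_seq_neq0 => /allP/(_ g gfs).
by rewrite big_map -E rmorph_prod.
Qed.

(** If [w] or [u] is even, [f] reduces to a [cheb_pair] of too large degree. Otherwise the
    recurrence rewrites [f] with [L = h.+1], [g1 = w], [g0 = w + u] and [be = u - w]. *)
Lemma odd_diameter h : n = h.*2 -> (3 <= h)%N ->
  [/\ ~~ (2 %| w)%Z, ~~ (2 %| u)%Z & (h <= 5)%N].
Proof.
move=> nE h3; have fE' : char_factor w u n =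
    w%:P * (V h.+2 + V h.+1) + u%:P * (V h.+1 + V h).
  by rewrite /char_factor nE (half_chebE _ h.+1).2 (half_chebE _ h).2.
have E : mod2 (char_factor w u n) =
    mod2 w%:P * cheb_pair h.+1 + mod2 u%:P * cheb_pair h.
  by rewrite fE' mod2_lin !mod2_pair.
have [w2|ow] := boolP (2 %| w)%Z.
  have ou : ~~ (2 %| u)%Z by apply/negP => u2; case: wu.
  rewrite (mod2_0 w2) (mod2_1 ou) mul0r add0r mul1r in E.
  by have := cheb_pair_le2 E; rewrite leqNgt h3.
have [u2|ou] := boolP (2 %| u)%Z.
  rewrite (mod2_1 ow) (mod2_0 u2) mul0r addr0 mul1r in E.
  by have := cheb_pair_le2 E; rewrite ltnNge ltnW.
split=> //; rewrite -ltnS.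
have sum2 (a b : int) : ~~ (2 %| a)%Z -> ~~ (2 %| b)%Z -> (2 %| a + b)%Z by lia.
apply: (@factors_small_index fs h.+1 w (w + u) (u - w)) => //.
- by rewrite -fE fE' [V h.+2]chebSS succnK polyCB polyCD; ring.
- by apply: sum2 => //; rewrite rpredN.
- by right; split=> //; ring.
Qed.

(** Here [L] is [h.+1] for [w] even and [h.+2] for [u] even; for both odd, [f] reduces to
    [cheb_pair h.+1]. *)
Lemma even_diameter h : n = h.*2.+1 -> (2 <= h)%N -> (h <= 5)%N.
Proof.
move=> nE h2; have fE' : char_factor w u n = w%:P * V h.+2 + u%:P * V h.+1.
  by rewrite /char_factor nE (half_chebE _ h.+2).1 (half_chebE _ h.+1).1.
have E : mod2 (char_factor w u n) =
    mod2 w%:P * cheb 'X h.+2 + mod2 u%:P * cheb 'X h.+1.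
  by rewrite fE' mod2_lin !mod2_cheb.
rewrite -ltnS.
have [w2|ow] := boolP (2 %| w)%Z.
  have ou : ~~ (2 %| u)%Z by apply/negP => u2; case: wu.
  apply: (@factors_small_index fs h.+1 w u (- w)) => //.
  - by rewrite -fE fE' [V h.+2]chebSS succnK polyCN; ring.
  - by rewrite rpredN.
  - by left.
have [u2|ou] := boolP (2 %| u)%Z.
  apply: ltnW; apply: (@factors_small_index fs h.+2 0 w u) => //.
  - by rewrite -fE fE' succnK polyC0; ring.
  - by left; rewrite dvdz0.
rewrite (mod2_1 ow) (mod2_1 ou) !mul1r in E.
by have := cheb_pair_le2 E; rewrite ltnNge; case: ltngtP h2.
Qed.

End Parity.

(** * Diameter 11 *)

(* In terms of [Y = x + 2], with [del = 1 - u / w] and [K = q + 1 / q + 2], the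
   members of the pencil are proportional to
   [S (4 - Y) (del ^+ 2 + (1 - del) Y)
     - (K - Y) (9 del ^+ 2 + 2 del + 10 (1 - del) Y)]. *)
Lemma pencil_roots_eq (R : realFieldType) (del K Y Z : R) :
    0 < del < 1 -> 2 + 2 * del <= K * del -> 13 / 5 <= Y <= 4 ->
    del <= (5 + 10 * del) * Z ->
    let den y := (4 - y) * (del ^+ 2 + (1 - del) * y) in
    let num y := (K - y) * (9 * del ^+ 2 + 2 * del + 10 * (1 - del) * y) in
  num Y * den Z = num Z * den Y -> Y = Z.
Proof.
move=> /andP[d0 d1] Kd /andP[Y1 Y2] dZ den num E.
pose F0 := 9 * del ^+ 2 + 2 * del.
(* Dividing [num Y * den Z - num Z * den Y] by [Y - Z] leaves [C0 + C1 * (Y + Z) + C2 * (Y * Z)], to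
   be shown positive. *)
pose C0 := K * ((1 - del) * (4 * del ^+ 2 - 8 * del) + del ^+ 2 * F0)
  - 4 * del ^+ 2 * F0.
pose C1 := (1 - del) * (K * F0 - 40 * del ^+ 2).
pose C2 := (1 - del) * (10 * (1 - del) * (K - 4) + del ^+ 2 - 2 * del).
have KE : K = (K * del - 2 - 2 * del) / del + 2 / del + 2.
  by field; rewrite gt_eqF.
(* The slack in the lower bound for [K], so that [K = m + 2 / del + 2]. *)
set m := (K * del - 2 - 2 * del) / del in KE.
have m0 : 0 <= m by rewrite divr_ge0 ?(ltW d0) //; lra.
clearbody m.
have dK : del * K = 2 + 2 * del + m * del by rewrite KE; field; rewrite gt_eqF.
have KF : K * F0 = (9 * del + 2) * (2 + 2 * del + m * del).
  by rewrite -dK /F0; ring.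
have s0 : 0 < 1 - del by lra.
have md : 0 <= (9 * del + 2) * (m * del).
  by rewrite mulr_ge0 ?mulr_ge0 ?(ltW d0) //; lra.
have C1_ge0 : 0 <= C1.
  rewrite mulr_ge0 ?(ltW s0) ?(ltW d0) // KF.
  have := md.
  have : 0 <= del * (1 - del) by rewrite mulr_ge0 ?ltW.
  by nra.
have C2_ge0 : 0 <= C1 + 4 * C2.
  have -> : C1 + 4 * C2 = (1 - del) * (K * F0 - 36 * del ^+ 2 - 8 * del +
     40 * (1 - del) * (K - 4)) by rewrite /C1 /C2; ring.
  rewrite mulr_ge0 ?(ltW s0) ?(ltW d0) // KF.
  have : 0 <= del * ((1 - del) * (K - 4) - 2 * (1 - del) ^+ 2).
    have -> : del * ((1 - del) * (K - 4) - 2 * (1 - del) ^+ 2) =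
      (1 - del) * (del * K - 4 * del - 2 * del * (1 - del)) by ring.
    rewrite dK; have -> : 2 + 2 * del + m * del - 4 * del - 2 * del * (1 - del)
      = 2 * (1 - del) ^+ 2 + m * del by ring.
    by rewrite mulr_ge0 ?(ltW s0) // addr_ge0 // mulr_ge0 ?sqr_ge0 ?(ltW d0).
  rewrite pmulr_rge0 // => h.
  have h2 := md.
  by nra.
(* Positivity at the corner [Y = 13 / 5], [Z = del / (5 + 10 * del)], cleared of denominators. *)
have T_gt0 : 0 < (5 + 10 * del) * (C0 + 13 / 5 * C1) + del * (C1 + 13 / 5 * C2).
  have -> : (5 + 10 * del) * (C0 + 13 / 5 * C1) + del * (C1 + 13 / 5 * C2) =
    (m * (60 * del + 365 * del ^+ 2 + 1040 * del ^+ 3 - 1090 * del ^+ 4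
      + 450 * del ^+ 5) + (1 - del) * (120 + 450 * del + del ^+ 2 *
      (1674 - 1907 * del + 900 * del ^+ 2))) / 5.
    by rewrite /C0 /C1 /C2 /F0 KE; field; rewrite gt_eqF.
  rewrite divr_gt0 // ltr_wpDl //.
    rewrite mulr_ge0 //.
    have -> : 60 * del + 365 * del ^+ 2 + 1040 * del ^+ 3 - 1090 * del ^+ 4
      + 450 * del ^+ 5 = 60 * del + 315 * del ^+ 2 + 1040 * del ^+ 3 * (1 - del)
      + 50 * del ^+ 2 * (1 - del) * (1 + del) + 450 * del ^+ 5 by ring.
    by rewrite !addr_ge0 ?mulr_ge0 ?exprn_ge0 ?(ltW s0) ?(ltW d0) //; lra.
  rewrite mulr_gt0 // ltr_wpDr //; last by lra.
  by rewrite mulr_ge0 ?sqr_ge0 //; nra.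
have : (Y - Z) * (C0 + C1 * (Y + Z) + C2 * (Y * Z)) = 0.
  transitivity (num Y * den Z - num Z * den Y); last by rewrite E subrr.
  by rewrite /num /den /C0 /C1 /C2 /F0; ring.
move/eqP; rewrite mulf_eq0 subr_eq0 => /orP[/eqP//|/eqP Q0].
suff : 0 < (5 + 10 * del) * (C0 + C1 * (Y + Z) + C2 * (Y * Z)).
  by rewrite Q0 mulr0 ltxx.
(* Expansion from that corner; the increments have nonnegative coefficients by [C1_ge0] and
   [C2_ge0]. *)
have -> : (5 + 10 * del) * (C0 + C1 * (Y + Z) + C2 * (Y * Z)) =
  ((5 + 10 * del) * (C0 + 13 / 5 * C1) + del * (C1 + 13 / 5 * C2)) +
  ((5 + 10 * del) * Z - del) * (C1 + C2 * Y) +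
  (Y - 13 / 5) * ((5 + 10 * del) * C1 + del * C2) by field.
rewrite -addrA ltr_wpDr // addr_ge0 // mulr_ge0 ?subr_ge0 //.
  by nra.
by nra.
Qed.

(** In [Y = x + 2] the polynomial has alternating coefficients. Below the bound [Y < 1 / 15], and
    pairing consecutive terms shows a negative value. *)
Lemma char_factor11_root_bound (R : realFieldType) (w u x : R) :
    0 < u < w -> w * half_cheb x 11 + u * half_cheb x 9 = 0 ->
  1 - u / w <= (5 + 10 * (1 - u / w)) * (x + 2).
Proof.
move=> /andP[u0 uw]; have w0 : 0 < w by apply: lt_trans uw.
set del := 1 - u / w => E.
have uE : u = w * (1 - del) by rewrite /del; field; rewrite gt_eqF.
have d0 : 0 < del by rewrite subr_gt0 ltr_pdivrMr // mul1r.
have d1 : del < 1 by rewrite ltrBlDr ltrDl divr_gt0.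
clearbody del; rewrite uE in E; rewrite leNgt; apply/negP => lt.
set Y := x + 2 in lt; have xE : x = Y - 2 by rewrite /Y; ring.
have : - del + (5 + 10 * del) * Y - (20 + 15 * del) * Y ^+ 2 +
    (21 + 7 * del) * Y ^+ 3 - (8 + del) * Y ^+ 4 + Y ^+ 5 = 0.
  apply: (mulfI (negbT (gt_eqF w0))); rewrite mulr0 -E xE /half_cheb /=; ring.
clearbody Y; apply/eqP; rewrite lt_eqF // => {E}.
have Y2 : 0 <= Y ^+ 2 by rewrite sqr_ge0.
have Y15 : Y < 1 / 15 by nra.
have -> : - del + (5 + 10 * del) * Y - (20 + 15 * del) * Y ^+ 2 +
    (21 + 7 * del) * Y ^+ 3 - (8 + del) * Y ^+ 4 + Y ^+ 5 =
  - ((del - (5 + 10 * del) * Y) + Y ^+ 2 * ((20 + 15 * del) - (21 + 7 * del) * Y)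
    + Y ^+ 2 ^+ 2 * ((8 + del) - Y)) by ring.
have h1 : 0 <= (21 + 7 * del) * (1 / 15 - Y) by apply: mulr_ge0; lra.
have h2 : 0 <= Y ^+ 2 * ((20 + 15 * del) - (21 + 7 * del) * Y).
  by apply: mulr_ge0 => //; lra.
have h3 : 0 <= Y ^+ 2 ^+ 2 * ((8 + del) - Y).
  by apply: mulr_ge0; [exact: sqr_ge0 | lra].
lra.
Qed.

Section SignChange.
Variable R : realFieldType.

Lemma prod_sign_change (fs : seq {poly R}) a b :
  (\prod_(g <- fs) g).[a] * (\prod_(g <- fs) g).[b] < 0 ->
  exists2 g, g \in fs & g.[a] * g.[b] < 0.
Proof.
rewrite !horner_prod -big_split /= => neg.
apply/hasP; apply: contraTT neg => /hasPn pos; rewrite -leNgt.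
by rewrite big_seq prodr_ge0 // => g /pos; rewrite -leNgt.
Qed.

Lemma linear_sign_change (g : {poly R}) a b c : (size g <= 2)%N -> a < b < c ->
  g.[a] * g.[b] < 0 -> 0 < g.[b] * g.[c].
Proof.
move=> g2 /andP[ab bc].
have gE x : g.[x] = g`_0 + g`_1 * x.
  have /poly_size3E gE : (size g <= 3)%N by apply: leqW.
  have g20 : g`_2 = 0 by rewrite nth_default.
  transitivity (g`_0 + g`_1 * x + g`_2 * x ^+ 2); first by rewrite {1}gE !hornerE.
  by rewrite g20 mul0r addr0.
rewrite !gE; set p := g`_0 + g`_1 * b => neg.
have E : (g`_0 + g`_1 * a) * p = p ^+ 2 - p * g`_1 * (b - a) by rewrite /p; ring.
rewrite E subr_lt0 in neg.
have pB : 0 < p * g`_1.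
  by rewrite -(pmulr_lgt0 _ (_ : 0 < b - a)) ?subr_gt0 // (le_lt_trans _ neg) // sqr_ge0.
have -> : p * (g`_0 + g`_1 * c) = p ^+ 2 + p * g`_1 * (c - b) by rewrite /p; ring.
by rewrite ltr_wpDl ?sqr_ge0 // mulr_gt0 // subr_gt0.
Qed.

End SignChange.

Lemma quadratic_roots (R : rcfType) (g : {poly R}) a b :
    size g = 3%N -> a <= b -> g.[a] * g.[b] < 0 ->
  exists e e', [/\ a <= e <= b, e != e', root g e & root g e'].
Proof.
move=> g3 ab neg.
have [e eab ge] : exists2 e, a <= e <= b & root g e.
  have [ga|ga] := leP g.[a] 0.
    by apply: poly_ivt => //; rewrite ga /=; nra.
  have [|e eab] := @poly_ivt _ (- g) a b ab.
    by rewrite !hornerN oppr_le0 oppr_ge0 (ltW ga) /=; nra.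
  by rewrite rootN; exists e.
have gE x : g.[x] = g`_0 + g`_1 * x + g`_2 * x ^+ 2.
  have /poly_size3E gE : (size g <= 3)%N by rewrite g3.
  by rewrite {1}gE !hornerE.
have c2 : g`_2 != 0.
  have : lead_coef g != 0 by rewrite lead_coef_eq0 -size_poly_eq0 g3.
  by rewrite /lead_coef g3.
move/rootP: (ge); rewrite gE => ge0.
pose e' := - (g`_1 / g`_2) - e; exists e, e'.
have c1E : g`_1 = - g`_2 * (e + e') by rewrite /e'; field.
clearbody e'.
have c0E : g`_0 = g`_2 * (e * e').
  by apply/eqP; rewrite -subr_eq0; apply/eqP; rewrite -[RHS]ge0 c1E; ring.
have gE' x : g.[x] = g`_2 * ((x - e) * (x - e')).
  by rewrite gE c1E c0E; ring.
split=> //; last by rewrite /root gE' subrr !mulr0.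
apply: contraTneq neg => ee'; rewrite -leNgt !gE' -ee'.
have -> : g`_2 * ((a - e) * (a - e)) * (g`_2 * ((b - e) * (b - e))) =
  (g`_2 * ((a - e) * (b - e))) ^+ 2 by ring.
exact: sqr_ge0.
Qed.

Lemma odd_sub (a b : int) : ~~ (2 %| a)%Z -> ~~ (2 %| b)%Z -> (2 %| a - b)%Z.
Proof. lia. Qed.

Lemma odd_gap (a b : int) : ~~ (2 %| a)%Z -> ~~ (2 %| b)%Z -> 0 < b < a ->
  2 <= a - b.
Proof. lia. Qed.

Lemma one_odd (z : int) : 0 <> 1 + z *+ 2.
Proof. lia. Qed.

Section Diameter11.
Local Notation mod2 := (map_poly (intr : int -> 'F_2)).
Local Notation V := (@cheb {poly int} 'X).
Variables (q w u : int) (fs : seq {poly int}).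
Hypothesis fs3 : forall g, g \in fs -> (size g <= 3)%N.
Hypothesis fE : char_factor w u 8 = \prod_(g <- fs) g.
Hypotheses (ow : ~~ (2 %| w)%Z) (ou : ~~ (2 %| u)%Z).
Hypotheses (uw : 0 < u < w) (wq : w <= q).
Hypothesis fs_pencil : forall g, g \in fs -> size g = 3%N ->
  exists2 p, in_pencil q%:~R w%:~R u%:~R 8 p &
    p %= map_poly (intr : int -> rat) g.

Variable R : rcfType.
Local Notation toR := (map_poly (intr : int -> R)).

Let FE x : (\prod_(g <- map toR fs) g).[x] =
  w%:~R * half_cheb x 11 + u%:~R * half_cheb x 9.
Proof. by rewrite big_map -rmorph_prod -fE /= horner_char_factor. Qed.

Let u0 : 0 < u%:~R :> R. Proof. by rewrite ltr0z; case/andP: uw. Qed.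
Let uwR : u%:~R < w%:~R :> R. Proof. by rewrite ltr_int; case/andP: uw. Qed.

Let half_cheb9 (x : R) : half_cheb x 9 = x ^+ 4 + x ^+ 3 - 3 * x ^+ 2 - 2 * x + 1.
Proof. by rewrite /half_cheb /=; ring. Qed.
Let half_cheb11 (x : R) : half_cheb x 11 =
  x ^+ 5 + x ^+ 4 - 4 * x ^+ 3 - 3 * x ^+ 2 + 3 * x + 1.
Proof. by rewrite /half_cheb /=; ring. Qed.

Let F_a : 0 < (\prod_(g <- map toR fs) g).[3 / 5].
Proof.
have -> : (\prod_(g <- map toR fs) g).[3 / 5] =
  3323 / 3125 * (w%:~R - u%:~R) + 403 / 3125 * u%:~R.
  by rewrite FE half_cheb9 half_cheb11; field.
have := uwR; have := u0; lra.
Qed.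
Let F_b : (\prod_(g <- map toR fs) g).[1] < 0.
Proof. by rewrite FE half_cheb9 half_cheb11; have := uwR; have := u0; lra. Qed.
Let F_c : 0 < (\prod_(g <- map toR fs) g).[2].
Proof. by rewrite FE half_cheb9 half_cheb11; have := uwR; have := u0; lra. Qed.

(** Modulo 2, [f] is ['X] times the square of gold. This square, of degree 4, is coprime to both
    linear factors, so it would divide a cofactor of degree at most 3. *)
Let not_two_linear g1 g2 : g1 \in fs -> g2 \in rem g1 fs ->
  size g1 = 2%N -> size g2 = 2%N -> False.
Proof.
move=> g1fs g2fs s1 s2.
have fE' : \prod_(g <- fs) g = (w%:P * 'X + (w + u)%:P) * V 5 + (u - w)%:P * V 4.
  rewrite -fE /char_factor (half_chebE _ 5).2 (half_chebE _ 4).2 (chebSS _ 4).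
  by rewrite polyCB polyCD; ring.
have be2 : (2 %| u - w)%Z := odd_sub ou ow.
have g01 : (2 %| w)%Z /\ ~~ (2 %| w + u)%Z \/
    ~~ (2 %| w)%Z /\ w + u = 2 * w + (u - w).
  by right; split=> //; ring.
have mE := mod2_factors fE' be2 g01.
have small := mod2_factors_small fs3 fE' isT be2 g01.
have g2fs' : g2 \in fs by apply: mem_rem g2fs.
pose r := \prod_(g <- rem g2 (rem g1 fs)) g.
have rE : \prod_(g <- fs) g = g1 * (g2 * r).
  by rewrite (big_rem g1 g1fs) (big_rem g2 g2fs).
have gold_dvd : ('X ^+ 2 + 'X - 1) ^+ 2 %| mod2 g1 * (mod2 g2 * mod2 r).
  have <- : mod2 (\prod_(g <- fs) g) = mod2 g1 * (mod2 g2 * mod2 r).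
    by rewrite rE 2!rmorphM.
  have V5 : @cheb {poly 'F_2} 'X 5 = cheb_pair 2 ^+ 2 := cheb_mod2_odd 2.
  have p2 : cheb_pair 2 = 'X ^+ 2 + 'X - 1 by rewrite /cheb_pair /=; ring.
  by rewrite mE V5 p2 dvdp_mull.
have co g : g \in fs -> size g = 2%N ->
    coprimep (('X ^+ 2 + 'X - 1) ^+ 2) (mod2 g).
  move=> gfs sg; have [gn0 g3] := small g gfs.
  rewrite coprimep_expl // coprimep_sym.
  have [[t gE]|//] := gold_or_coprime gn0 g3.
  have g20 : g`_2 = 0 by rewrite nth_default // sg.
  have : g`_2 = 1 + t`_2 *+ 2.
    by rewrite gE mulr_natl coefD coefMn coefB coefD coefXn coefX coef1 addr0 subr0.
  by rewrite g20 => /one_odd.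
rewrite Gauss_dvdpr ?co // Gauss_dvdpr ?co // in gold_dvd.
have f0 : mod2 (\prod_(g <- fs) g) != 0.
  by rewrite rmorph_prod prodf_seq_neq0; apply/allP => g /small[].
have r0 : mod2 r != 0.
  by apply: contraNneq f0 => r0; rewrite rE 2!rmorphM /= r0 !mulr0.
have r5 : (5 <= size r)%N.
  apply: leq_trans (size_poly _ _ : (size (mod2 r) <= _)%N).
  apply: leq_trans (dvdp_leq r0 gold_dvd).
  have sg : size ('X ^+ 2 + 'X - 1 : {poly 'F_2}) = 3%N.
    by rewrite -addrA size_polyDl size_polyXn // -polyC1 size_XsubC.
  by rewrite expr2 size_mul -?size_poly_eq0 sg.
have : (size (\prod_(g <- fs) g)%R <= 6)%N.
  rewrite fE' (leq_trans (size_polyD _ _)) // geq_max; apply/andP; split.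
    rewrite (leq_trans (size_polyMleq _ _)) //.
    have l1 : (size (w%:P * 'X + (w + u)%:P)%R <= 2)%N.
      by rewrite size_MXaddC; case: ifP => // _; rewrite ltnS size_polyC_leq1.
    by rewrite -subn1 leq_subLR (leq_add l1 (size_cheb int 5).1).
  rewrite (leq_trans (size_polyMleq _ _)) // -subn1 leq_subLR.
  have := leq_add (size_polyC_leq1 (u - w)) (size_cheb int 4).1.
  by move/leq_trans; apply.
rewrite rE !size_mul ?mulf_neq0 -?size_poly_gt0 ?s1 ?s2 //.
- by move: (size r) r5 => [|[|[|[|[|l]]]]].
- by apply: leq_trans r5.
- by apply: leq_trans r5.
Qed.

Let size_sign_change g (a b : R) : (toR g).[a] * (toR g).[b] < 0 ->
  (1 < size g)%N.
Proof.
move=> neg; rewrite ltnNge; apply: contraTN neg => /size1_polyC->.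
by rewrite map_polyC !hornerC -leNgt -expr2 sqr_ge0.
Qed.

(** The signs +, -, + at 3/5, 1, 2 give two sign changes. One linear factor cannot produce both, and
    two linear factors are excluded. *)
Let quadratic_sign_change : exists g (a b : R), [/\ g \in fs, size g = 3%N,
  3 / 5 <= a <= b, b <= 2 & (toR g).[a] * (toR g).[b] < 0].
Proof.
have [_ /mapP[g1 g1fs ->] neg1] : exists2 g, g \in map toR fs &
    g.[3 / 5] * g.[1] < 0.
  by apply: prod_sign_change; rewrite (pmulr_rlt0 _ F_a); apply: F_b.
have [_ /mapP[g2 g2fs ->] neg2] : exists2 g, g \in map toR fs &
    g.[1] * g.[2] < 0.
  by apply: prod_sign_change; rewrite (pmulr_llt0 _ F_c); apply: F_b.
have s1 := size_sign_change neg1; have s2 := size_sign_change neg2.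
have [s13|s1'] := eqVneq (size g1) 3%N.
  by exists g1, (3 / 5), 1; split=> //; lra.
have [s23|s2'] := eqVneq (size g2) 3%N.
  by exists g2, 1, 2; split=> //; lra.
have {s1'}s1 : size g1 = 2%N by have := fs3 g1fs; case: (size g1) s1 s1' => [|[|[|[|l]]]].
have {s2'}s2 : size g2 = 2%N by have := fs3 g2fs; case: (size g2) s2 s2' => [|[|[|[|l]]]].
case: (not_two_linear g1fs _ s1 s2).
have [g12|g12] := eqVneq g2 g1; last first.
  by have := g2fs; rewrite (perm_mem (perm_to_rem g1fs)) inE (negPf g12).
have : 0 < (toR g1).[1] * (toR g1).[2].
  apply: linear_sign_change neg1; first by rewrite (leq_trans (size_poly _ _)) // s1.
  by apply/andP; split; lra.
by rewrite g12 in neg2; rewrite ltNge ltW.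
Qed.

(** Both roots of the quadratic factor satisfy the pencil equation with the same [S], which is what
    [pencil_roots_eq] forbids for distinct roots. *)
Lemma no_diameter_11 : False.
Proof.
have [g [a [b [gfs g3 /andP[a1 ab] b2 neg]]]] := quadratic_sign_change.
have sg : size (toR g) = 3%N by rewrite size_map_inj_poly //; apply: intr_inj.
have [e [e' [/andP[ae eb] ee' ge ge']]] := quadratic_roots sg ab neg.
have [p [S pE] pg] := fs_pencil gfs g3.
have F0 x : root (toR g) x -> w%:~R * half_cheb x 11 + u%:~R * half_cheb x 9 = 0.
  rewrite -FE => gx; apply/rootP.
  by rewrite big_map (big_rem g gfs) rootM gx.
have bound := char_factor11_root_bound (introT andP (conj u0 uwR)) (F0 _ ge').
have toRE : toR g = map_poly ratr (map_poly (intr : int -> rat) g).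
  by rewrite -map_poly_comp; apply: eq_map_poly => i /=; rewrite ratr_int.
have SE x : root (toR g) x -> ratr S * (pencil_den w%:~R u%:~R).[x] =
    (pencil_num q%:~R w%:~R u%:~R 8).[x] :> R.
  move=> gx; have : root (map_poly ratr p) x.
    by rewrite (eqp_root (_ : _ %= toR g)) // toRE eqp_map.
  rewrite pE rmorphB rmorphM /= map_polyC map_pencil_den map_pencil_num /= !ratr_int.
  by rewrite /root hornerD hornerN hornerCM subr_eq0 => /eqP.
have w0 : 0 < w%:~R :> R by apply: lt_trans uwR; apply: u0.
have q0 : 0 < q%:~R :> R by apply: lt_le_trans w0 _; rewrite ler_int.
pose del : R := 1 - u%:~R / w%:~R; pose K : R := q%:~R + q%:~R^-1 + 2.
have d0 : 0 < del by rewrite subr_gt0 ltr_pdivrMr // mul1r uwR.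
have d1 : del < 1 by rewrite ltrBlDr ltrDl divr_gt0 // u0.
(* Oddness of [w] and [u] gives [w - u >= 2], and [q >= w]. *)
have qd : 2 <= q%:~R * del.
  have uw2 : 2 <= w%:~R - u%:~R :> R.
    by rewrite -[2]/(2%:~R) -intrB ler_int odd_gap.
  have wd : w%:~R * del = w%:~R - u%:~R.
    by rewrite /del; field; rewrite gt_eqF.
  apply: le_trans uw2 _; rewrite -wd ler_pM2r // ler_int //.
have Kd : 2 + 2 * del <= K * del.
  have : 0 <= q%:~R^-1 * del by rewrite mulr_ge0 // ?invr_ge0 ltW.
  by rewrite /K; move: qd; set Q := q%:~R; set Q' := Q^-1 => *; lra.
suff : e + 2 = e' + 2 by move/addIr => E; rewrite E eqxx in ee'.
apply: (@pencil_roots_eq _ del K) => //; try (by apply/andP; split; lra).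
have dE x : (4 - (x + 2)) * (del ^+ 2 + (1 - del) * (x + 2)) =
    (pencil_den w%:~R u%:~R).[x] / w%:~R ^+ 2.
  by rewrite horner_pencil_den /del; field; rewrite gt_eqF.
have nE x : (K - (x + 2)) *
      (9 * del ^+ 2 + 2 * del + 10 * (1 - del) * (x + 2)) =
    (pencil_num q%:~R w%:~R u%:~R 8).[x] / (q%:~R * w%:~R ^+ 2).
  by rewrite horner_pencil_num /del /K; field; rewrite !gt_eqF.
by rewrite /= !dE !nE -!SE //; ring.
Qed.

End Diameter11.

(** * Conclusion *)

Lemma cheb_at2 (R : comNzRingType) n : cheb (2 : R) n = n%:R.
Proof.
suff [] : cheb (2 : R) n = n%:R /\ cheb (2 : R) n.+1 = n.+1%:R by [].
elim: n => [//|n [IH0 IH1]]; split=> //.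
by rewrite chebSS IH1 IH0 -!natr1; ring.
Qed.

Lemma char_factor_neq0 (w u : int) n : 0 < w -> 0 <= u -> char_factor w u n != 0.
Proof.
move=> w0 u0; apply/eqP => f0.
have := horner_char_factor w u n (2 : rat); rewrite f0 rmorph0 horner0 => /esym/eqP.
have half2 m : half_cheb (2 : rat) m = (m./2 + odd m * m./2.+1)%:R.
  rewrite /half_cheb; case: odd; rewrite !cheb_at2 ?mul1n ?mul0n ?addn0 //.
  by rewrite -natrD addnC.
rewrite !half2 gt_eqF // ltr_wpDr ?mulr_ge0 ?ler0z ?ler0n //.
by rewrite mulr_gt0 ?ltr0z // ltr0n addn_gt0 /=.
Qed.

Theorem theorem5p1 (k c : int) (d : nat) (hk : 3 <= k) (hc : 1 <= c <= k - 1)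
    (hd : d = 11%N \/ (15 <= d)%N) :
  ~ exists (T : finType) (e : rel T),
      distance_regular e /\ is_quotient_matrix e (Bmx k d.+1 c).
Proof.
have [n dE] : exists n, d = n.+3 by exists (d - 3)%N; lia.
rewrite dE => -[T [e [[[e_sym _] [T0 _] _] eB]]].
have [hk1 hc1] : 2 <= k - 1 /\ 0 <= c - 1 < k - 1 by split; lia.
pose g := gcdz (k - 1) (c - 1).
have g0 : 0 < g.
  by rewrite /g /gcdz ltz_nat gcdn_gt0 absz_gt0 gt_eqF //; lia.
have [w kE] : exists w, k - 1 = g * w.
  by have /dvdzP[w ->] := dvdz_gcdl (k - 1) (c - 1); exists w; rewrite mulrC.
have [u cE] : exists u, c - 1 = g * u.
  by have /dvdzP[u ->] := dvdz_gcdr (k - 1) (c - 1); exists u; rewrite mulrC.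
have w0 : 0 < w by rewrite -(pmulr_rgt0 _ g0) -kE; lia.
have u0 : 0 <= u by rewrite -(pmulr_rge0 _ g0) -cE; lia.
have uw : u < w by rewrite -(ltr_pM2l g0) -kE -cE; case/andP: hc1.
have wq : w <= k - 1 by rewrite kE ler_peMl ?(ltW w0) // -gtz0_ge1.
have wu : ~ ((2 %| w)%Z /\ (2 %| u)%Z).
  case=> w2 u2; have : (g * 2 %| g)%Z.
    by rewrite dvdz_gcd kE cE !dvdz_mul.
  rewrite dvdzE abszM /=; apply/negP.
  by rewrite gtnNdvd ?ltn_Pmulr ?absz_gt0 ?gt_eqF.
have [fs [fE fsP]] := prod_small_factors (char_factor_neq0 n w0 u0)
  (char_factor_pencil hk hc e_sym eB T0 g0 kE cE).
have fs3 h : h \in fs -> (size h <= 3)%N by case/fsP.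
case: hd => [d11|d15].
  have n8 : n = 8%N by lia.
  rewrite n8 in fE fsP.
  have [ow ou _] := odd_diameter fs3 fE wu (erefl : 8 = 4.*2)%N isT.
  (* The real algebraic numbers serve as the real closed field; [u] is positive because it is
     odd. *)
  apply: (@no_diameter_11 (k - 1) w u fs fs3 fE ow ou _ wq _ algR).
    by rewrite uw andbT lt0r u0 andbT; apply: contraNneq ou => ->.
  by move=> h /fsP[].
(* With [d = n.+3], the bound 5 on [n./2] gives [d <= 14] for odd [n] and [d <= 13] for even [n]. *)
have nE := odd_double_half n.
have [on|en] := boolP (odd n); rewrite ?on ?(negPf en) /= in nE.
  have h2 : (2 <= n./2)%N by lia.
  have := even_diameter fs3 fE wu (esym nE) h2; lia.
have h3 : (3 <= n./2)%N by lia.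
have [_ _] := odd_diameter fs3 fE wu (esym nE) h3; lia.
Qed.
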